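(* Let $M=S^2$ be the unit sphere with longitude $\theta$ and colatitude $\varphi$, let $\mu>0$ and $\omega,c\in\mathbb{R}$ be constants, and let $a=2\omega\cos(\varphi)$. Set \[ u^K=c\,\partial_\theta,\qquad p_K=\tfrac12\big(c^2\sin(\varphi)^2+c\,\omega\cos(2\varphi)\big). \] Let $u=u^K+\hat u$, $p=p_K+\hat p$ be a solution of the Navier–Stokes system with Coriolis term \[ u_t+\nabla_u u-\mu\, Lu+a\,Ku+\mathsf{grad}(p)=0,\qquad \mathsf{div}(u)=0 \] on $S^2$. Then \[ \frac{d}{dt}\|\hat u\|^2\le 0 . \]
   Context: All fields are smooth. $S^2$ is regarded as a submanifold of $\mathbb{R}^3$ with the induced metric $g$, the $x_3$ axis being the axis of rotation (rotation vector $(0,0,\omega)$). $\nabla$ is the Levi-Civita connection, $\mathsf{grad}(p)=g^{ij}p_{;j}$, $\mathsf{div}(u)=u^i_{;i}$. In $u^k_{;ij}$ the rightmost index is the last covariant derivative taken. $Lu=\mathsf{div}(Su)$ with $(Su)^{kj}=g^{ki}u^j_{;i}+g^{ij}u^k_{;i}$, i.e. $(Lu)^j=g^{ki}u^j_{;ik}+g^{ij}u^k_{;ik}$. In positively oriented coordinates $\varepsilon=\sqrt{\det g}\,(dx_1\otimes dx_2-dx_2\otimes dx_1)$ and $(Ku)^k=g^{ki}\varepsilon_{ij}u^j$; the orientation is the outward one, in which $(\partial_\varphi,\partial_\theta)$ is positively oriented, so $K\partial_\theta=\sin(\varphi)\,\partial_\varphi$. With these conventions $(u^K,p_K)$ is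 itself a (stationary) solution of the system. $\|\hat u\|^2=\int_M g(\hat u,\hat u)\,\omega_M$, with $\omega_M$ the Riemannian volume form. *)

(* Defs.v *)
From Stdlib Require Import Reals.
From Coquelicot Require Import Coquelicot.
Open Scope R_scope.

(** * Smooth functions *)

Definition dirD {V : NormedModule R_AbsRing} (v : V) (f : V -> R) (x : V) : R :=
  Derive (fun s : R => f (plus x (scal s v))) 0.

(* [D] is meant to be open: [dirD] looks at a neighbourhood of each point. *)
Fixpoint Ck {V : NormedModule R_AbsRing} (k : nat) (D : V -> Prop) (f : V -> R)
  {struct k} : Prop :=
  (forall x, D x -> continuous f x) /\
  match k with
  | O => True
  | S k' => forall v : V,
      (forall x, D x -> ex_derive (fun s : R => f (plus x (scal s v))) 0) /\
      Ck k' D (dirD v f)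
  end.

Definition smooth {V : NormedModule R_AbsRing} (D : V -> Prop) (f : V -> R) : Prop :=
  forall k, Ck k D f.

(** * The unit sphere in R^3 *)

Definition R2 : Type := (R * R)%type.
Definition R3 : Type := (R * R * R)%type.

Definition x1 (x : R3) : R := fst (fst x).
Definition x2 (x : R3) : R := snd (fst x).
Definition x3 (x : R3) : R := snd x.

Definition dot (x y : R3) : R := x1 x * x1 y + x2 x * x2 y + x3 x * x3 y.

Definition det3 (x y z : R3) : R :=
  x1 x * (x2 y * x3 z - x3 y * x2 z)
  - x2 x * (x1 y * x3 z - x3 y * x1 z)
  + x3 x * (x1 y * x2 z - x2 y * x1 z).

Definition S2 (x : R3) : Prop := dot x x = 1.

(* Time-dependent objects on the sphere are written as functions on [R3] of
   which only the values on [S2] matter.  Smoothness on J x S^2 (J open) is the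
   usual one for a subset of a Euclidean space: near each point the function
   is the restriction of a smooth function of (t,x) defined on an open set. *)
Definition smooth_S2 (J : R -> Prop) (f : R -> R3 -> R) : Prop :=
  forall t x, J t -> S2 x ->
  exists (W : R * (R * R * R) -> Prop) (F : R * (R * R * R) -> R),
    open W /\ W (t, x) /\ smooth W F /\
    forall s y, W (s, y) -> J s -> S2 y -> F (s, y) = f s y.

Definition smooth_vector_field (J : R -> Prop) (u : R -> R3 -> R3) : Prop :=
  (forall t x, J t -> S2 x -> dot x (u t x) = 0) /\
  smooth_S2 J (fun t x => x1 (u t x)) /\
  smooth_S2 J (fun t x => x2 (u t x)) /\
  smooth_S2 J (fun t x => x3 (u t x)).

(** * Tensor calculus in local coordinates *)

Inductive idx : Set := i1 | i2.

Definition sum2 (f : idx -> R) : R := f i1 + f i2.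

Definition partial (i : idx) (f : R2 -> R) (q : R2) : R :=
  match i with
  | i1 => Derive (fun s => f (s, snd q)) (fst q)
  | i2 => Derive (fun s => f (fst q, s)) (snd q)
  end.

Section Coordinates.

(* Coordinates are given by their inverse, a local parametrization of S^2. *)
Variable psi : R2 -> R3.

Definition frame (i : idx) (q : R2) : R3 :=
  (partial i (fun r => x1 (psi r)) q,
   partial i (fun r => x2 (psi r)) q,
   partial i (fun r => x3 (psi r)) q).

Definition g_ (i j : idx) (q : R2) : R := dot (frame i q) (frame j q).

Definition detg (q : R2) : R := g_ i1 i1 q * g_ i2 i2 q - g_ i1 i2 q * g_ i2 i1 q.

Definition ginv (i j : idx) (q : R2) : R :=
  match i, j with
  | i1, i1 => g_ i2 i2 q / detg q
  | i1, i2 => - g_ i1 i2 q / detg q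
  | i2, i1 => - g_ i2 i1 q / detg q
  | i2, i2 => g_ i1 i1 q / detg q
  end.

Definition Christoffel (k i j : idx) (q : R2) : R :=
  / 2 * sum2 (fun l => ginv k l q *
    (partial i (g_ j l) q + partial j (g_ i l) q - partial l (g_ i j) q)).

(* [w k] is the component w^k. *)
Implicit Type w : idx -> R2 -> R.

(* [cov w k i] is w^k_{;i} *)
Definition cov w (k i : idx) (q : R2) : R :=
  partial i (w k) q + sum2 (fun l => Christoffel k i l q * w l q).

(* [cov2 w k i j] is w^k_{;ij}, the derivative with respect to j being the last. *)
Definition cov2 w (k i j : idx) (q : R2) : R :=
  partial j (cov w k i) q
  + sum2 (fun l => Christoffel k j l q * cov w l i q)
  - sum2 (fun l => Christoffel l j i q * cov w k l q).

Definition divergence w (q : R2) : R := sum2 (fun i => cov w i i q).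

Definition gradient (p : R2 -> R) (k : idx) (q : R2) : R :=
  sum2 (fun j => ginv k j q * partial j p q).

(* (nabla_v w)^k *)
Definition nabla (v w : idx -> R2 -> R) (k : idx) (q : R2) : R :=
  sum2 (fun i => v i q * cov w k i q).

Definition Lop w (j : idx) (q : R2) : R :=
  sum2 (fun k => sum2 (fun i => ginv k i q * cov2 w j i k q))
  + sum2 (fun k => sum2 (fun i => ginv i j q * cov2 w k i k q)).

Definition eps (i j : idx) (q : R2) : R :=
  match i, j with
  | i1, i2 => sqrt (detg q)
  | i2, i1 => - sqrt (detg q)
  | _, _ => 0
  end.

Definition Kop w (k : idx) (q : R2) : R :=
  sum2 (fun i => sum2 (fun j => ginv k i q * eps i j q * w j q)).

(* For [u] tangent to the sphere, u = sum_i (comp u i) (frame i). *)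
Definition comp (u : R3 -> R3) (i : idx) (q : R2) : R :=
  sum2 (fun j => ginv i j q * dot (frame j q) (u (psi q))).

End Coordinates.

(* Since the frame spans the tangent plane and [psi q] is the outward normal,
   the last clause says that [psi] is an immersion compatible with the outward
   orientation. *)
Definition oriented_chart (D : R * R -> Prop) (psi : R2 -> R3) : Prop :=
  open D /\
  (forall q, D q -> S2 (psi q)) /\
  smooth D (fun q : R * R => x1 (psi q)) /\
  smooth D (fun q : R * R => x2 (psi q)) /\
  smooth D (fun q : R * R => x3 (psi q)) /\
  (forall q r, D q -> D r -> psi q = psi r -> q = r) /\
  (forall q, D q -> 0 < det3 (psi q) (frame psi i1 q) (frame psi i2 q)).

(** * The Navier-Stokes system on the sphere *)

Definition NS_solution (mu : R) (a : R3 -> R) (J : R -> Prop)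
    (u : R -> R3 -> R3) (p : R -> R3 -> R) : Prop :=
  smooth_vector_field J u /\
  smooth_S2 J p /\
  forall (D : R * R -> Prop) (psi : R2 -> R3), oriented_chart D psi ->
  forall t q, J t -> D q ->
  let ut := comp psi (u t) in
  (forall k : idx,
     Derive (fun s => comp psi (u s) k q) t
     + nabla psi ut ut k q
     - mu * Lop psi ut k q
     + a (psi q) * Kop psi ut k q
     + gradient psi (fun r => p t (psi r)) k q = 0) /\
  divergence psi ut q = 0.

(** * Spherical coordinates *)

(* First coordinate: colatitude; second coordinate: longitude. *)
Definition sph (q : R2) : R3 :=
  (sin (fst q) * cos (snd q), sin (fst q) * sin (snd q), cos (fst q)).

Definition colatitude (x : R3) : R := acos (x3 x).

(* The coordinate field of the longitude, extended by 0 to the poles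
   (see [frame_sph_theta]). *)
Definition d_theta (x : R3) : R3 := (- x2 x, x1 x, 0).

Lemma frame_sph_theta (q : R2) : frame sph i2 q = d_theta (sph q).
Proof.
destruct q as [phi theta]; unfold frame, d_theta, sph, x1, x2, x3, partial; simpl.
f_equal; [f_equal|]; apply is_derive_unique; auto_derive; trivial; ring.
Qed.

Lemma colatitude_sph (phi theta : R) :
  0 <= phi <= PI -> colatitude (sph (phi, theta)) = phi.
Proof. intros H; unfold colatitude, sph, x3; simpl; now apply acos_cos. Qed.

(* The spherical chart covers S^2 up to a null set, hence the integral of [f]
   against the Riemannian volume form is computed in it. *)
Definition integral_S2 (f : R3 -> R) : R :=
  RInt (fun phi =>
    RInt (fun theta => f (sph (phi, theta)) * sqrt (detg sph (phi, theta)))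
      0 (2 * PI)) 0 PI.

Definition sqnorm (u : R3 -> R3) : R := integral_S2 (fun x => dot (u x) (u x)).

Definition coriolis (omega : R) (x : R3) : R := 2 * omega * cos (colatitude x).

Definition uK (c : R) (x : R3) : R3 := scal c (d_theta x).

Definition pK (omega c : R) (x : R3) : R :=
  / 2 * (c ^ 2 * sin (colatitude x) ^ 2 + c * omega * cos (2 * colatitude x)).

(* Main.v *)
Require Import Defs.
From Stdlib Require Import Reals Lra.
From Stdlib Require Import FunctionalExtensionality Classical ClassicalEpsilon.
From Coquelicot Require Import Coquelicot.
Open Scope R_scope.

(** The theorem is an energy estimate.  Pair the equation for u with u - u^K
and integrate over the sphere.  The inertial, Coriolis and pressure terms
integrate to zero because u is divergence free, u^K is a Killing field and K is
skew; the viscous term gives minus the integral of mu |S|^2 / 2, where S is the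
symmetrized covariant derivative of u, which is also that of u - u^K.

The computation is made in spherical coordinates, in the orthonormal frame
(e_phi, e_theta).  Let v and W be the components of u there and put
s = sin phi, C = cos phi, y = W - c s, so that (v, y) are the components of
u - u^K.  The pointwise identity [energy_balance] says that, for 0 < phi < PI,
s (v v_t + y y_t) equals the phi-derivative of a meridional flux, plus the
theta-derivative of a zonal flux, minus mu s |S|^2 / 2.  The viscous term takes
this form because L is the divergence of S.  The inertial and Coriolis terms
caused by u^K do not vanish pointwise: they leave s v times the derivative of a
function of phi.  Together with the pressure and the kinetic energy this
function forms the Bernoulli function

  Q = (v^2 + y^2) / 2 + p + (omega c - c^2 / 2) s^2,

and the divergence of Q u is absorbed in the two fluxes.

The identity degenerates at the poles, but the integration does not have to
avoid them.  Composing u with the parametrization [sph] gives components v, W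
that are smooth for all real phi and theta ([smooth_S2_sph]), and the
meridional flux is a polynomial in them, their derivatives and s, C, hence
smooth.  At the poles u is a fixed vector, seen from a rotating frame, so that
W = v_theta at phi = 0 and W = - v_theta at phi = PI; this makes the meridional
flux vanish at both ends.  The zonal flux does contain 1/s, but it only needs to
be integrated in theta at fixed phi, where it is periodic.  This is
[RInt_flux_nonpos].

The analytic input is the chain rule for functions with continuous directional
derivatives, which gives stability of [smooth] under composition
([smooth_comp]), and differentiation under a double integral
([is_derive_RInt2]), which rests on the joint continuity of parameter integrals
([continuous_RInt_param]). *)

(** * Functions with continuous directional derivatives *)

Lemma plus_scal_0 {V : NormedModule R_AbsRing} (x e : V) : plus x (scal 0 e) = x.
Proof. exact (eq_trans (f_equal (plus x) (scal_zero_l e)) (plus_zero_r x)). Qed.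

Lemma is_derive_along {V : NormedModule R_AbsRing} (F : V -> R) (x e : V) (r : R) :
  ex_derive (fun s : R => F (plus (plus x (scal r e)) (scal s e))) 0 ->
  is_derive (fun s : R => F (plus x (scal s e))) r (dirD e F (plus x (scal r e))).
Proof.
intros H; apply Derive_correct in H.
replace (dirD e F (plus x (scal r e))) with
  (1 * Derive (fun s : R => F (plus (plus x (scal r e)) (scal s e))) 0)
  by (unfold dirD; ring).
assert (E : forall s : R, s = r + (s - r)) by (intros; ring).
apply (is_derive_ext
  (fun s : R => F (plus (plus x (scal r e)) (scal (s - r) e)))).
  intros s; rewrite <- plus_assoc.
  apply f_equal, f_equal; symmetry.
  refine (eq_trans _ (scal_distr_r r (s - r) e)).
  exact (f_equal (fun z : R => scal z e) (E s)).
apply (is_derive_comp (fun s : R => F (plus (plus x (scal r e)) (scal s e)))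
  (fun s : R => s - r)).
- now replace (r - r) with 0 by ring.
- auto_derive; trivial; ring.
Qed.

(** One step of the chain rule: moving along [e] by a small amount [a s] from a
moving base point [b s] changes [F] by [a s] times its derivative at a nearby
point, by the mean value theorem on the segment.  Continuity of the derivative
makes the error negligible, whatever the speed of [b]. *)
Lemma is_derive_increment {V : NormedModule R_AbsRing} (F : V -> R) (e x : V)
    (b : R -> V) (a : R -> R) (s0 a' : R) :
  locally x (fun y => ex_derive (fun s : R => F (plus y (scal s e))) 0) ->
  continuous (dirD e F) x ->
  continuous b s0 -> b s0 = x -> is_derive a s0 a' -> a s0 = 0 ->
  is_derive (fun s => F (plus (b s) (scal (a s) e)) - F (b s)) s0
    (a' * dirD e F x).
Proof.
intros HF Hc Hb Hbx Ha Ha0.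
set (d := dirD e F x).
set (rho := fun s => F (plus (b s) (scal (a s) e)) - F (b s) - d * a s).
apply (is_derive_ext (fun s => rho s + d * a s)).
  intros s; unfold rho; simpl; lra.
replace (a' * d) with (0 + d * a') by ring.
apply (is_derive_plus rho); [| now apply (is_derive_scal a)].
(* It remains to see that [rho s] is small compared with [a s]. *)
assert (Hest : forall eps : posreal, locally s0 (fun s => Rabs (rho s) <= eps * Rabs (a s))).
{ intros eps.
  assert (HP : locally x (fun y =>
      ex_derive (fun s : R => F (plus y (scal s e))) 0 /\
      ball d eps (dirD e F y))).
  { apply filter_and; trivial.
    apply (Hc (ball d eps)); apply locally_ball. }
  assert (Hm : continuous (fun z : V * R => plus (fst z) (scal (snd z) e)) (x, 0)).
  { apply (continuous_plus (fun z : V * R => fst z)).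
      apply continuous_fst.
    apply (continuous_scal (fun z : V * R => snd z) (fun _ => e)).
      apply continuous_snd.
    apply continuous_const. }
  assert (E0 : plus x (scal 0 e) = x) by apply plus_scal_0.
  unfold continuous in Hm; simpl in Hm; rewrite E0 in Hm.
  destruct (Hm _ HP) as [del Hdel].
  assert (Hb' : locally s0 (fun s => ball x del (b s))).
  { rewrite <- Hbx; apply (Hb (ball (b s0) del)); rewrite Hbx; apply locally_ball. }
  assert (Ha' : locally s0 (fun s => ball 0 del (a s))).
  { assert (Hac : continuous a s0) by (apply (ex_derive_continuous a); now exists a').
    rewrite <- Ha0; apply (Hac (ball (a s0) del)); apply locally_ball. }
  generalize (filter_and _ _ Hb' Ha'); apply filter_imp.
  intros s [Hbs Has].
  set (G := fun r : R => F (plus (b s) (scal r e))).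
  assert (Hr : forall r, Rmin 0 (a s) <= r <= Rmax 0 (a s) ->
     is_derive G r (dirD e F (plus (b s) (scal r e))) /\
     ball d eps (dirD e F (plus (b s) (scal r e)))).
  { intros r Hr.
    destruct (Hdel (b s, r)) as [H1 H2].
    - split; simpl; trivial.
      change (Rabs (r - 0) < del).
      change (Rabs (a s - 0) < del) in Has.
      revert Has Hr; unfold Rmin, Rmax; destruct (Rle_dec 0 (a s));
        unfold Rabs; repeat destruct Rcase_abs; lra.
    - split; trivial; now apply is_derive_along. }
  destruct (MVT_gen G 0 (a s) (fun r => dirD e F (plus (b s) (scal r e))))
    as [r [Hr1 Hr2]].
  - intros r Hr'; apply Hr; lra.
  - intros r Hr'; apply derivable_continuous_pt.
    exists (dirD e F (plus (b s) (scal r e))); apply is_derive_Reals, Hr; lra.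
  - unfold rho.
    replace (F (plus (b s) (scal (a s) e))) with (G (a s)) by reflexivity.
    replace (F (b s)) with (G 0).
      2: { unfold G; now rewrite plus_scal_0. }
    rewrite Hr2.
    replace (_ - d * a s) with ((dirD e F (plus (b s) (scal r e)) - d) * a s) by ring.
    rewrite Rabs_mult.
    apply Rmult_le_compat_r; [apply Rabs_pos|].
    left; apply (Hr r Hr1). }
apply is_derive_Reals; apply is_derive_Reals in Ha.
intros eps Heps.
destruct (Ha 1 Rlt_0_1) as [d1 Hd1].
assert (Hp : 0 < Rabs a' + 1) by (generalize (Rabs_pos a'); lra).
assert (He : 0 < eps / 2 / (Rabs a' + 1)) by (repeat apply Rdiv_lt_0_compat; lra).
destruct (Hest (mkposreal _ He)) as [d2 Hd2].
assert (Hm : 0 < Rmin d1 d2) by (apply Rmin_pos; apply cond_pos).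
exists (mkposreal _ Hm); intros h Hh0 Hh; simpl in Hh.
assert (rho s0 = 0) as ->.
{ unfold rho; rewrite Ha0, plus_scal_0; ring. }
specialize (Hd1 h Hh0 (Rlt_le_trans _ _ _ Hh (Rmin_l _ _))).
rewrite Ha0, Rminus_0_r in Hd1.
specialize (Hd2 (s0 + h)); simpl in Hd2.
assert (Hb2 : ball s0 d2 (s0 + h)).
{ change (Rabs (s0 + h - s0) < d2); replace (s0 + h - s0) with h by ring.
  apply (Rlt_le_trans _ _ _ Hh), Rmin_r. }
specialize (Hd2 Hb2).
rewrite !Rminus_0_r.
assert (Hq : Rabs (a (s0 + h) / h) <= Rabs a' + 1).
{ replace (a (s0 + h) / h) with ((a (s0 + h) / h - a') + a') by ring.
  generalize (Rabs_triang (a (s0 + h) / h - a') a'); lra. }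
unfold Rdiv in *; rewrite Rabs_mult in *.
assert (Hh' : 0 <= Rabs (/ h)) by apply Rabs_pos.
apply Rle_lt_trans with
  (eps * / 2 * / (Rabs a' + 1) * Rabs (a (s0 + h)) * Rabs (/ h)).
  now apply Rmult_le_compat_r.
apply Rle_lt_trans with (eps * / 2 * / (Rabs a' + 1) * (Rabs a' + 1)).
  rewrite Rmult_assoc; apply Rmult_le_compat_l; lra.
field_simplify; lra.
Qed.

Section SmoothFunctions.

Context {V : NormedModule R_AbsRing}.
Implicit Types (D : V -> Prop) (f g : V -> R) (l : V -> R).

Lemma smooth_continuous D f x : smooth D f -> D x -> continuous f x.
Proof. intros H; apply (H O). Qed.

Lemma smooth_dirD D f v : smooth D f -> smooth D (dirD v f).
Proof. intros H k; apply (H (S k)). Qed.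

Lemma smooth_ex_derive D f x v : smooth D f -> D x ->
  ex_derive (fun s : R => f (plus x (scal s v))) 0.
Proof. intros H; apply (proj2 (H 1%nat)). Qed.

Lemma Ck_pred k D f : Ck (S k) D f -> Ck k D f.
Proof.
revert f; induction k as [|k IH]; intros f [Hc H]; split; trivial.
intros v; destruct (H v) as [H1 H2]; split; [exact H1 | exact (IH _ H2)].
Qed.

Lemma Ck_local k D f :
  (forall x, D x -> exists D' : V -> Prop, D' x /\ Ck k D' f) -> Ck k D f.
Proof.
revert f; induction k as [|k IH]; intros f H; split; trivial.
- intros x Hx; destruct (H x Hx) as [D' [HD' [Hc _]]]; auto.
- intros x Hx; destruct (H x Hx) as [D' [HD' [Hc _]]]; auto.
- intros v; split.
  + intros x Hx; destruct (H x Hx) as [D' [HD' [_ Hd]]]; now apply Hd.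
  + apply IH; intros x Hx; destruct (H x Hx) as [D' [HD' [_ Hd]]].
    exists D'; split; trivial; apply Hd.
Qed.

Lemma smooth_local D f :
  (forall x, D x -> exists D' : V -> Prop, D' x /\ smooth D' f) -> smooth D f.
Proof.
intros H k; apply Ck_local; intros x Hx; destruct (H x Hx) as [D' [H1 H2]].
now exists D'.
Qed.

Lemma smooth_subset D D' f :
  (forall x, D' x -> D x) -> smooth D f -> smooth D' f.
Proof. intros H Hf; apply smooth_local; intros x Hx; exists D; auto. Qed.

Lemma continuous_line (x v : V) :
  continuous (fun s : R => plus x (scal s v)) 0.
Proof.
apply (continuous_plus (fun _ : R => x)); [apply continuous_const|].
apply (continuous_scal (fun s : R => s) (fun _ => v));
  [apply continuous_id | apply continuous_const].
Qed.

Lemma locally_line D (x v : V) : open D -> D x ->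
  locally (0 : R) (fun s : R => D (plus x (scal s v))).
Proof.
intros HD Hx; apply (continuous_line x v D).
rewrite plus_scal_0; now apply HD.
Qed.

Lemma Ck_ext k D f g : open D -> (forall x, D x -> f x = g x) ->
  Ck k D f -> Ck k D g.
Proof.
intros HD; revert f g; induction k as [|k IH]; intros f g E H.
all: assert (Hc : forall x, D x -> continuous g x) by
  (intros x Hx; apply (continuous_ext_loc g f x);
    [generalize (HD x Hx); apply filter_imp; intros y Hy; now apply E | now apply H]).
all: split; trivial.
intros v; destruct H as [_ H]; specialize (H v).
assert (El : forall x, D x -> locally (0 : R) (fun s : R =>
    f (plus x (scal s v)) = g (plus x (scal s v)))).
{ intros x Hx; generalize (locally_line D x v HD Hx); apply filter_imp.
  intros; now apply E. }
split.
- intros x Hx; apply (ex_derive_ext_loc (fun s : R => f (plus x (scal s v))));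
    [now apply El | now apply H].
- apply (IH (dirD v f)); [| apply H].
  intros x Hx; now apply Derive_ext_loc, El.
Qed.

Lemma smooth_ext D f g : open D -> (forall x, D x -> f x = g x) ->
  smooth D f -> smooth D g.
Proof. intros HD E H k; now apply (Ck_ext k D f). Qed.

Lemma dirD_const (a : R) v : dirD v (fun _ : V => a) = fun _ => 0.
Proof. apply functional_extensionality; intros x; exact (Derive_const a 0). Qed.

Lemma Ck_const k D (a : R) : Ck k D (fun _ => a).
Proof.
revert a; induction k as [|k IH]; intros a; split; trivial;
  try (intros; apply continuous_const).
intros v; split; [intros; apply ex_derive_const|].
rewrite dirD_const; apply IH.
Qed.

Lemma Ck_plus k D f g : open D ->
  Ck k D f -> Ck k D g -> Ck k D (fun x => f x + g x).
Proof.
intros HD; revert f g; induction k as [|k IH]; intros f g [Cf Hf] [Cg Hg];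
  split; trivial; try (intros; apply (continuous_plus f g); auto).
intros v; split.
- intros x Hx; apply @ex_derive_plus; [now apply Hf | now apply Hg].
- apply (Ck_ext k D (fun x => dirD v f x + dirD v g x)); trivial.
  + intros x Hx; symmetry; apply Derive_plus; [now apply Hf | now apply Hg].
  + apply IH; [apply Hf | apply Hg].
Qed.

Lemma Ck_mult k D f g : open D ->
  Ck k D f -> Ck k D g -> Ck k D (fun x => f x * g x).
Proof.
intros HD; revert f g; induction k as [|k IH]; intros f g Hf Hg.
all: assert (Hc : forall x, D x -> continuous (fun x => f x * g x) x) by
  (intros x Hx; apply (continuous_mult f g); [now apply Hf | now apply Hg]).
all: split; trivial.
intros v; split.
- intros x Hx; apply ex_derive_mult; [now apply Hf | now apply Hg].
- apply (Ck_ext k D (fun x => dirD v f x * g x + f x * dirD v g x)); trivial.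
  + intros x Hx; unfold dirD.
    rewrite (Derive_mult (fun s : R => f (plus x (scal s v)))
      (fun s : R => g (plus x (scal s v)))); [| now apply Hf | now apply Hg].
    now rewrite plus_scal_0.
  + apply Ck_plus; trivial; apply IH; try (apply Hf); try (apply Hg);
      now apply Ck_pred.
Qed.

Lemma smooth_const D (a : R) : smooth D (fun _ => a).
Proof. intros k; apply Ck_const. Qed.

Lemma smooth_plus D f g : open D ->
  smooth D f -> smooth D g -> smooth D (fun x => f x + g x).
Proof. intros HD Hf Hg k; now apply Ck_plus. Qed.

Lemma smooth_mult D f g : open D ->
  smooth D f -> smooth D g -> smooth D (fun x => f x * g x).
Proof. intros HD Hf Hg k; now apply Ck_mult. Qed.

Lemma smooth_opp D f : open D -> smooth D f -> smooth D (fun x => - f x).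
Proof.
intros HD Hf; apply (smooth_ext D (fun x => -1 * f x)); trivial.
  intros; ring.
apply smooth_mult; trivial; apply smooth_const.
Qed.

Lemma smooth_minus D f g : open D ->
  smooth D f -> smooth D g -> smooth D (fun x => f x - g x).
Proof. intros; apply smooth_plus; trivial; now apply smooth_opp. Qed.

Lemma linear_line l (x v : V) (s : R) :
  is_linear l -> l (plus x (scal s v)) = l x + s * l v.
Proof. intros Hl; rewrite (linear_plus l Hl), (linear_scal l Hl); reflexivity. Qed.

Lemma smooth_linear D l : is_linear l -> smooth D l.
Proof.
intros Hl [|k]; (split; [intros x _; exact (linear_cont l x Hl)|]); trivial.
intros v; split.
- intros x _; apply (ex_derive_ext (fun s : R => l x + s * l v)).
    intros s; symmetry; now apply linear_line.
  auto_derive; trivial.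
- replace (dirD v l) with (fun _ : V => l v); [apply Ck_const|].
  apply functional_extensionality; intros x; unfold dirD.
  rewrite (Derive_ext _ (fun s : R => l x + s * l v)).
    symmetry; apply is_derive_unique; auto_derive; trivial; ring.
  intros s; now apply linear_line.
Qed.

(** Sine and cosine are treated together, as each is the derivative of the
other up to a constant factor. *)
Lemma smooth_sin_cos_linear D l : open D -> is_linear l ->
  smooth D (fun x => sin (l x)) /\ smooth D (fun x => cos (l x)).
Proof.
intros HD Hl; enough (H : forall k,
  Ck k D (fun x => sin (l x)) /\ Ck k D (fun x => cos (l x)))
  by (split; intros k; apply (H k)).
assert (Ds : forall x v, is_derive (fun s : R => sin (l (plus x (scal s v)))) 0
    (l v * cos (l x))).
{ intros x v; apply (is_derive_ext (fun s : R => sin (l x + s * l v))).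
    intros s; now rewrite linear_line.
  auto_derive; trivial; replace (l x + 0 * l v) with (l x) by ring; ring. }
assert (Dc : forall x v, is_derive (fun s : R => cos (l (plus x (scal s v)))) 0
    (- l v * sin (l x))).
{ intros x v; apply (is_derive_ext (fun s : R => cos (l x + s * l v))).
    intros s; now rewrite linear_line.
  auto_derive; trivial; replace (l x + 0 * l v) with (l x) by ring; ring. }
assert (Cs : forall x, continuous (fun x => sin (l x)) x).
{ intros x; apply (continuous_comp l sin);
    [exact (linear_cont l x Hl) | apply continuous_sin]. }
assert (Cc : forall x, continuous (fun x => cos (l x)) x).
{ intros x; apply (continuous_comp l cos);
    [exact (linear_cont l x Hl) | apply continuous_cos]. }
induction k as [|k [IHs IHc]].
  split; split; auto.
split; (split; [intros x _; first [exact (Cs x) | exact (Cc x)]|]);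
  intros v; split.
- intros x _; eexists; apply Ds.
- apply (Ck_ext k D (fun x => l v * cos (l x))); trivial.
    intros x _; symmetry; apply is_derive_unique, Ds.
  apply Ck_mult; trivial; apply Ck_const.
- intros x _; eexists; apply Dc.
- apply (Ck_ext k D (fun x => - l v * sin (l x))); trivial.
    intros x _; symmetry; apply is_derive_unique, Dc.
  apply Ck_mult; trivial; apply Ck_const.
Qed.

End SmoothFunctions.

(** * Composition of smooth functions *)

Definition e0 : R * (R * R * R) := (1, (0, 0, 0)).
Definition e1 : R * (R * R * R) := (0, (1, 0, 0)).
Definition e2 : R * (R * R * R) := (0, (0, 1, 0)).
Definition e3 : R * (R * R * R) := (0, (0, 0, 1)).

Lemma continuous_pair {T U1 U2 : UniformSpace} (f : T -> U1) (g : T -> U2) (x : T) :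
  continuous f x -> continuous g x -> continuous (fun y => (f y, g y)) x.
Proof.
intros Hf Hg; apply (continuous_comp_2 f g (fun a b => (a, b))); trivial.
apply (continuous_ext (fun z : U1 * U2 => z)); [now intros [a b] | apply continuous_id].
Qed.

(** The coordinates are moved one at a time: the increment of [F] along the path
is the sum of four increments, each in a basis direction from a base point
that is itself moving. *)
Lemma is_derive_path (W : R * (R * R * R) -> Prop) (F : R * (R * R * R) -> R)
    (T X Y Z : R -> R) (s0 T' X' Y' Z' : R) :
  let P := (T s0, (X s0, Y s0, Z s0)) in
  open W -> Ck 1 W F -> W P ->
  is_derive T s0 T' -> is_derive X s0 X' -> is_derive Y s0 Y' -> is_derive Z s0 Z' ->
  is_derive (fun s => F (T s, (X s, Y s, Z s))) s0
    (T' * dirD e0 F P + X' * dirD e1 F P + Y' * dirD e2 F P + Z' * dirD e3 F P).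
Proof.
intros P HW HF HP DT DX DY DZ.
assert (Hstep : forall (e : R * (R * R * R)) (b : R -> R * (R * R * R)) (f : R -> R) (f' : R),
  continuous b s0 -> b s0 = P -> is_derive f s0 f' ->
  is_derive (fun s => F (plus (b s) (scal (f s - f s0) e)) - F (b s)) s0
    (f' * dirD e F P)).
{ intros e b f f' Hb HbP Hf.
  apply (is_derive_increment F e P b (fun s => f s - f s0)); trivial; try ring.
  - generalize (HW P HP); apply filter_imp; intros y Hy.
    now apply (proj1 (proj2 HF e)).
  - now apply (proj1 (proj2 (proj2 HF e))).
  - replace f' with (f' - 0) by ring.
    apply (is_derive_minus f (fun _ => f s0)); trivial; apply @is_derive_const. }
assert (CT : continuous T s0) by (apply (ex_derive_continuous T); now exists T').
assert (CX : continuous X s0) by (apply (ex_derive_continuous X); now exists X').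
assert (CY : continuous Y s0) by (apply (ex_derive_continuous Y); now exists Y').
pose proof (Hstep e0 (fun _ => P) T T' (continuous_const _ _) eq_refl DT) as H0.
pose proof (Hstep e1 (fun s => (T s, (X s0, Y s0, Z s0))) X X') as H1.
pose proof (Hstep e2 (fun s => (T s, (X s, Y s0, Z s0))) Y Y') as H2.
pose proof (Hstep e3 (fun s => (T s, (X s, Y s, Z s0))) Z Z') as H3.
specialize (H1 
  ltac:(repeat apply continuous_pair; trivial; apply continuous_const) eq_refl DX).
specialize (H2 
  ltac:(repeat apply continuous_pair; trivial; apply continuous_const) eq_refl DY).
specialize (H3 
  ltac:(repeat apply continuous_pair; trivial; apply continuous_const) eq_refl DZ).
pose proof (is_derive_plus _ _ _ _ _ (is_derive_plus _ _ _ _ _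
  (is_derive_plus _ _ _ _ _ H0 H1) H2) H3) as H.
pose proof (is_derive_plus _ _ _ _ _ (is_derive_const (F P) s0) H) as H'.
rewrite <- (Rplus_0_l (T' * _ + _ + _ + _)).
revert H'; apply is_derive_ext; intros s.
unfold P, e0, e1, e2, e3.
do 5 (unfold prod_plus, prod_scal, plus, scal, mult; simpl).
repeat match goal with |- context [?a + (?f ?s - ?a) * 1] =>
  replace (a + (f s - a) * 1) with (f s) by ring end.
rewrite !Rmult_0_r, !Rplus_0_r; ring.
Qed.

Lemma open_preimage {T U : UniformSpace} (f : T -> U) (D : T -> Prop) (W : U -> Prop) :
  open D -> open W -> (forall x, D x -> continuous f x) ->
  open (fun x => D x /\ W (f x)).
Proof.
intros HD HW Hf x [Hx HWx]; apply filter_and; [now apply HD|].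
apply (Hf x Hx); now apply HW.
Qed.

(** By induction on the order: the directional derivative of the composite is a
combination of smooth factors and of composites of the derivatives of [F],
which have one order less. *)
Lemma smooth_comp {V : NormedModule R_AbsRing} (D : V -> Prop)
    (W : R * (R * R * R) -> Prop) (F : R * (R * R * R) -> R) (T X Y Z : V -> R) :
  open D -> open W -> (forall x, D x -> W (T x, (X x, Y x, Z x))) ->
  smooth D T -> smooth D X -> smooth D Y -> smooth D Z ->
  smooth W F -> smooth D (fun x => F (T x, (X x, Y x, Z x))).
Proof.
intros HD HW HDW ST SX SY SZ SF k; specialize (SF k); revert F SF.
assert (HC : forall F x, Ck 0 W F -> D x ->
  continuous (fun x => F (T x, (X x, Y x, Z x))) x).
{ intros F x HF Hx.
  apply (continuous_comp (fun x => (T x, (X x, Y x, Z x))) F).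
  - repeat apply continuous_pair; now apply (smooth_continuous D).
  - now apply HF, HDW. }
induction k as [|k IH]; intros F HF.
  split; trivial; intros x Hx; now apply HC.
split.
  intros x Hx; apply HC; trivial; split; trivial; apply HF.
intros v.
assert (Hd : forall x, D x -> is_derive (fun s : R => F (T (plus x (scal s v)),
    (X (plus x (scal s v)), Y (plus x (scal s v)), Z (plus x (scal s v))))) 0
  (dirD v T x * dirD e0 F (T x, (X x, Y x, Z x))
   + dirD v X x * dirD e1 F (T x, (X x, Y x, Z x))
   + dirD v Y x * dirD e2 F (T x, (X x, Y x, Z x))
   + dirD v Z x * dirD e3 F (T x, (X x, Y x, Z x)))).
{ intros x Hx.
  assert (Hd : forall f : V -> R, smooth D f ->
    is_derive (fun s : R => f (plus x (scal s v))) 0 (dirD v f x)).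
  { intros f Sf; apply Derive_correct; now apply (smooth_ex_derive D). }
  pose proof (is_derive_path W F (fun s => T (plus x (scal s v)))
    (fun s => X (plus x (scal s v))) (fun s => Y (plus x (scal s v)))
    (fun s => Z (plus x (scal s v))) 0 (dirD v T x) (dirD v X x)
    (dirD v Y x) (dirD v Z x) HW) as H.
  cbv zeta beta in H; rewrite plus_scal_0 in H.
  apply H; auto.
  split; [apply HF|]; intros w; split; [apply (proj2 HF w)|].
  destruct HF as [_ HF]; destruct (HF w) as [_ HF'].
  destruct k; [exact HF'| split; trivial; apply HF']. }
split.
- intros x Hx; eexists; now apply Hd.
- destruct HF as [_ HF].
  apply (Ck_ext k D (fun x => dirD v T x * dirD e0 F (T x, (X x, Y x, Z x))
   + dirD v X x * dirD e1 F (T x, (X x, Y x, Z x))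
   + dirD v Y x * dirD e2 F (T x, (X x, Y x, Z x))
   + dirD v Z x * dirD e3 F (T x, (X x, Y x, Z x)))); trivial.
    intros x Hx; symmetry; apply is_derive_unique; now apply Hd.
  assert (HM : forall (f : V -> R) e, smooth D f ->
      Ck k D (fun x => dirD v f x * dirD e F (T x, (X x, Y x, Z x)))).
  { intros f e Sf; apply Ck_mult; trivial.
    - exact (smooth_dirD D f v Sf k).
    - exact (IH _ (proj2 (HF e))). }
  repeat apply Ck_plus; trivial; apply HM; trivial.
Qed.

(** * Smooth fields in spherical coordinates *)

Definition et : R * (R * R) := (1, (0, 0)).
Definition ephi : R * (R * R) := (0, (1, 0)).
Definition etheta : R * (R * R) := (0, (0, 1)).

Section PartialDerivatives.

Variables (D : R * (R * R) -> Prop) (f : R * (R * R) -> R).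
Hypothesis Sf : smooth D f.
Variables t phi theta : R.
Hypothesis Dx : D (t, (phi, theta)).

Lemma is_derive_t :
  is_derive (fun s => f (s, (phi, theta))) t (dirD et f (t, (phi, theta))).
Proof.
assert (E : forall s : R, plus (0, (phi, theta)) (scal s et) = (s, (phi, theta))).
{ intros s; unfold et.
  do 5 (unfold prod_plus, prod_scal, plus, scal, mult; simpl).
  now rewrite !Rmult_0_r, !Rplus_0_r, Rplus_0_l, Rmult_1_r. }
pose proof (is_derive_along f (0, (phi, theta)) et t) as H.
rewrite E in H; specialize (H (smooth_ex_derive D f _ et Sf Dx)).
revert H; apply is_derive_ext; intros s; now rewrite E.
Qed.

Lemma is_derive_phi :
  is_derive (fun s => f (t, (s, theta))) phi (dirD ephi f (t, (phi, theta))).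
Proof.
assert (E : forall s : R, plus (t, (0, theta)) (scal s ephi) = (t, (s, theta))).
{ intros s; unfold ephi.
  do 5 (unfold prod_plus, prod_scal, plus, scal, mult; simpl).
  now rewrite !Rmult_0_r, !Rplus_0_r, Rplus_0_l, Rmult_1_r. }
pose proof (is_derive_along f (t, (0, theta)) ephi phi) as H.
rewrite E in H; specialize (H (smooth_ex_derive D f _ ephi Sf Dx)).
revert H; apply is_derive_ext; intros s; now rewrite E.
Qed.

Lemma is_derive_theta :
  is_derive (fun s => f (t, (phi, s))) theta (dirD etheta f (t, (phi, theta))).
Proof.
assert (E : forall s : R, plus (t, (phi, 0)) (scal s etheta) = (t, (phi, s))).
{ intros s; unfold etheta.
  do 5 (unfold prod_plus, prod_scal, plus, scal, mult; simpl).
  now rewrite !Rmult_0_r, !Rplus_0_r, Rplus_0_l, Rmult_1_r. }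
pose proof (is_derive_along f (t, (phi, 0)) etheta theta) as H.
rewrite E in H; specialize (H (smooth_ex_derive D f _ etheta Sf Dx)).
revert H; apply is_derive_ext; intros s; now rewrite E.
Qed.

End PartialDerivatives.

Lemma is_linear_phi : is_linear (fun x : R * (R * R) => fst (snd x)).
Proof. apply (is_linear_comp snd fst); [apply is_linear_snd | apply is_linear_fst]. Qed.

Lemma is_linear_theta : is_linear (fun x : R * (R * R) => snd (snd x)).
Proof. apply (is_linear_comp snd snd); apply is_linear_snd. Qed.

Lemma smooth_sph {V : NormedModule R_AbsRing} (D : V -> Prop) (l m : V -> R) :
  open D -> is_linear l -> is_linear m ->
  smooth D (fun x => x1 (sph (l x, m x))) /\
  smooth D (fun x => x2 (sph (l x, m x))) /\
  smooth D (fun x => x3 (sph (l x, m x))).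
Proof.
intros HD Hl Hm.
destruct (smooth_sin_cos_linear D l HD Hl) as [Sl Cl].
destruct (smooth_sin_cos_linear D m HD Hm) as [Sm Cm].
repeat split; trivial; now apply smooth_mult.
Qed.

Lemma sph_S2 q : S2 (sph q).
Proof.
unfold S2, dot, sph, x1, x2, x3; simpl.
generalize (sin2_cos2 (fst q)) (sin2_cos2 (snd q)); unfold Rsqr; intros H1 H2.
transitivity (sin (fst q) * sin (fst q) *
  (sin (snd q) * sin (snd q) + cos (snd q) * cos (snd q))
  + cos (fst q) * cos (fst q)); [ring|].
rewrite H2; lra.
Qed.

Lemma open_time (J : R -> Prop) : open J -> open (fun x : R * (R * R) => J (fst x)).
Proof. intros HJ; apply (open_comp fst); trivial; intros; apply continuous_fst. Qed.

(** A smooth field on the sphere becomes smooth in all real values of the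
coordinates, including those where [sph] is not an immersion. *)
Lemma smooth_S2_sph (J : R -> Prop) (f : R -> R3 -> R) :
  open J -> smooth_S2 J f ->
  smooth (fun x : R * (R * R) => J (fst x)) (fun x => f (fst x) (sph (snd x))).
Proof.
intros HJ Hf; apply smooth_local; intros [t q] Ht; simpl in Ht.
destruct (Hf t (sph q) Ht (sph_S2 q)) as (W & F & HW & HWx & HF & E).
set (T := fun x : R * (R * R) => fst x).
set (X := fun x : R * (R * R) => x1 (sph (fst (snd x), snd (snd x)))).
set (Y := fun x : R * (R * R) => x2 (sph (fst (snd x), snd (snd x)))).
set (Z := fun x : R * (R * R) => x3 (sph (fst (snd x), snd (snd x)))).
assert (ST : forall D, smooth D T).
{ intros D; apply smooth_linear, is_linear_fst. }
destruct (smooth_sph (fun _ : R * (R * R) => True) _ _ open_true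
  is_linear_phi is_linear_theta) as (SX & SY & SZ).
fold X in SX; fold Y in SY; fold Z in SZ.
assert (HD : open (fun x : R * (R * R) => J (fst x) /\ W (T x, (X x, Y x, Z x)))).
{ refine (open_preimage (fun x : R * (R * R) => (T x, (X x, Y x, Z x)))
    (fun x => J (fst x)) W (open_time J HJ) HW _).
  intros x _; repeat apply continuous_pair;
    [ exact (smooth_continuous _ T x (ST (fun _ => True)) I)
    | exact (smooth_continuous _ X x SX I) | exact (smooth_continuous _ Y x SY I)
    | exact (smooth_continuous _ Z x SZ I) ]. }
exists (fun x : R * (R * R) => J (fst x) /\ W (T x, (X x, Y x, Z x))); split.
  split; trivial; now destruct q.
apply (smooth_ext _ (fun x => F (T x, (X x, Y x, Z x)))); trivial.
  intros [s [a b]] [H1 H2]; apply E; trivial; apply sph_S2.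
apply (smooth_comp _ W); trivial; try (now intros x [_ H]);
  apply (smooth_subset (fun _ => True)); trivial.
Qed.

(** * Tensor calculus and energy balance in spherical coordinates *)

Lemma frame_sph_phi (q : R2) : frame sph i1 q =
  (cos (fst q) * cos (snd q), cos (fst q) * sin (snd q), - sin (fst q)).
Proof.
destruct q as [phi theta]; unfold frame, sph, x1, x2, x3, partial; simpl.
f_equal; [f_equal|]; apply is_derive_unique; auto_derive; trivial; ring.
Qed.

Lemma g_sph (i j : idx) : g_ sph i j = fun q =>
  match i, j with i1, i1 => 1 | i2, i2 => sin (fst q) ^ 2 | _, _ => 0 end.
Proof.
apply functional_extensionality; intros [phi theta]; unfold g_.
pose proof (sin2_cos2 phi) as Hp; pose proof (sin2_cos2 theta) as Ht.
unfold Rsqr in Hp, Ht.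
destruct i, j; rewrite ?frame_sph_phi, ?frame_sph_theta;
  unfold dot, d_theta, sph, x1, x2, x3; simpl.
- transitivity (cos phi * cos phi * (sin theta * sin theta + cos theta * cos theta)
    + sin phi * sin phi); [ring | rewrite Ht; lra].
- ring.
- ring.
- transitivity (sin phi * sin phi * (sin theta * sin theta + cos theta * cos theta));
    [ring | rewrite Ht; ring].
Qed.

Lemma detg_sph q : detg sph q = sin (fst q) ^ 2.
Proof. unfold detg; rewrite !g_sph; ring. Qed.

Lemma partial_g_sph (k i j : idx) q : partial k (g_ sph i j) q =
  match k, i, j with i1, i2, i2 => 2 * sin (fst q) * cos (fst q) | _, _, _ => 0 end.
Proof.
rewrite g_sph; destruct k, i, j; unfold partial; simpl;
  apply is_derive_unique; auto_derive; trivial; ring.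
Qed.

(** The points away from the poles, where the coordinates are an immersion. *)
Definition regular (q : R2) : Prop := sin (fst q) <> 0.

Lemma Christoffel_sph (k i j : idx) q : regular q -> Christoffel sph k i j q =
  match k, i, j with
  | i1, i2, i2 => - sin (fst q) * cos (fst q)
  | i2, i1, i2 | i2, i2, i1 => cos (fst q) / sin (fst q)
  | _, _, _ => 0
  end.
Proof.
intros Hq; unfold Christoffel, sum2; rewrite !partial_g_sph.
destruct k, i, j; unfold ginv; rewrite detg_sph, ?g_sph; field; exact Hq.
Qed.

Lemma ginv_sph (i j : idx) q : regular q -> ginv sph i j q =
  match i, j with i1, i1 => 1 | i2, i2 => / sin (fst q) ^ 2 | _, _ => 0 end.
Proof.
intros Hq; destruct i, j; unfold ginv; rewrite detg_sph, ?g_sph; field; exact Hq.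
Qed.

Lemma regular_near phi theta : regular (phi, theta) ->
  locally phi (fun s => regular (s, theta)).
Proof.
intros H; apply (continuous_sin phi (fun y => y <> 0)).
now apply open_neq.
Qed.

Lemma partial_ext_regular (i : idx) (f h : R2 -> R) q :
  (forall r, regular r -> f r = h r) -> regular q ->
  partial i f q = partial i h q.
Proof.
destruct q as [phi theta]; intros E Hq; destruct i; unfold partial; simpl.
- apply Derive_ext_loc; generalize (regular_near phi theta Hq); apply filter_imp.
  intros; now apply E.
- apply Derive_ext; intros s; now apply E.
Qed.

Lemma is_derive_mult_R (f h : R -> R) (x f' h' : R) :
  is_derive f x f' -> is_derive h x h' ->
  is_derive (fun r => f r * h r) x (f' * h x + f x * h').
Proof. intros Hf Hh; apply (is_derive_mult f h); trivial; intros; apply Rmult_comm. Qed.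

Lemma is_derive_combination (a b f h : R -> R) (x a' b' f' h' : R) :
  is_derive a x a' -> is_derive b x b' -> is_derive f x f' -> is_derive h x h' ->
  is_derive (fun r => a r * f r + b r * h r) x
    ((a' * f x + a x * f') + (b' * h x + b x * h')).
Proof.
intros; apply (is_derive_plus (fun r => a r * f r));
  now apply is_derive_mult_R.
Qed.

Lemma is_derive_inv_sin (x : R) : sin x <> 0 ->
  is_derive (fun r => / sin r) x (- cos x / sin x ^ 2).
Proof. intros Hx; auto_derive; trivial; field; exact Hx. Qed.

Lemma is_derive_cot (x : R) : sin x <> 0 ->
  is_derive (fun r => cos r / sin r) x (- 1 - cos x ^ 2 / sin x ^ 2).
Proof. intros Hx; auto_derive; trivial; field; exact Hx. Qed.

Definition has_partials (f f1 f2 : R2 -> R) : Prop := forall q,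
  is_derive (fun s => f (s, snd q)) (fst q) (f1 q) /\
  is_derive (fun s => f (fst q, s)) (snd q) (f2 q).

(** A vector field is represented by its components [v] and [W] in the
orthonormal frame rather than by its coordinate components [w], since only
the former stay smooth at the poles. *)
Section SphericalComponents.

Variable w : idx -> R2 -> R.
Variables v v1 v2 W W1 W2 : R2 -> R.
Hypothesis Ev : forall q, regular q -> w i1 q = v q.
Hypothesis EW : forall q, regular q -> w i2 q = W q / sin (fst q).
Hypothesis Dv : has_partials v v1 v2.
Hypothesis DW : has_partials W W1 W2.

Lemma cov_sph (k i : idx) q : regular q -> cov sph w k i q =
  match k, i with
  | i1, i1 => v1 q
  | i1, i2 => v2 q - cos (fst q) * W q
  | i2, i1 => W1 q / sin (fst q)
  | i2, i2 => (W2 q + cos (fst q) * v q) / sin (fst q)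
  end.
Proof.
intros Hq; unfold cov, sum2.
rewrite !Christoffel_sph, Ev, EW by trivial.
destruct (Dv q) as [Dv1 Dv2], (DW q) as [DW1 DW2].
assert (P : partial i (w k) q = match k, i with
  | i1, i1 => v1 q
  | i1, i2 => v2 q
  | i2, i1 => W1 q / sin (fst q) - W q * cos (fst q) / sin (fst q) ^ 2
  | i2, i2 => W2 q / sin (fst q)
  end).
{ destruct k.
  - rewrite (partial_ext_regular i (w i1) v q Ev Hq).
    destruct i; now apply is_derive_unique.
  - rewrite (partial_ext_regular i (w i2) (fun r => W r / sin (fst r)) q EW Hq).
    destruct i; apply is_derive_unique; simpl.
    + evar_last; [apply is_derive_div; [exact DW1 | apply is_derive_sin | exact Hq]|].
      destruct q; simpl; field; exact Hq.
    + apply (is_derive_ext (fun s => / sin (fst q) * W (fst q, s))).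
        intros s; simpl; unfold Rdiv; ring.
      evar_last; [apply is_derive_scal; exact DW2|]; simpl; unfold Rdiv; ring. }
rewrite P; destruct k, i; field; exact Hq.
Qed.

Lemma divergence_sph q : regular q ->
  divergence sph w q = v1 q + (W2 q + cos (fst q) * v q) / sin (fst q).
Proof. intros Hq; unfold divergence, sum2; now rewrite !cov_sph. Qed.

Lemma nabla_sph (k : idx) q : regular q -> nabla sph w w k q =
  match k with
  | i1 => v q * v1 q + W q / sin (fst q) * (v2 q - cos (fst q) * W q)
  | i2 => (v q * W1 q
      + W q / sin (fst q) * (W2 q + cos (fst q) * v q)) / sin (fst q)
  end.
Proof.
intros Hq; unfold nabla, sum2; rewrite !cov_sph, Ev, EW by trivial.
destruct k; field; exact Hq.
Qed.

Lemma Kop_sph (k : idx) q : regular q -> 0 <= sin (fst q) -> Kop sph w k q =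
  match k with i1 => W q | i2 => - v q / sin (fst q) end.
Proof.
intros Hq Hs; unfold Kop, sum2; rewrite !ginv_sph, Ev, EW by trivial.
unfold eps; rewrite detg_sph, sqrt_pow2 by trivial.
destruct k; field; exact Hq.
Qed.

Variables v11 v12 v21 v22 W11 W12 W21 W22 : R2 -> R.
Hypothesis Dv1 : has_partials v1 v11 v12.
Hypothesis Dv2 : has_partials v2 v21 v22.
Hypothesis DW1 : has_partials W1 W11 W12.
Hypothesis DW2 : has_partials W2 W21 W22.

Lemma partial_cov_sph (k i j : idx) q : regular q -> partial j (cov sph w k i) q =
  let s := sin (fst q) in let C := cos (fst q) in
  match k, i, j with
  | i1, i1, i1 => v11 q
  | i1, i1, i2 => v12 q
  | i1, i2, i1 => v21 q + s * W q - C * W1 q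
  | i1, i2, i2 => v22 q - C * W2 q
  | i2, i1, i1 => W11 q / s - W1 q * C / s ^ 2
  | i2, i1, i2 => W12 q / s
  | i2, i2, i1 => (W21 q - s * v q + C * v1 q) / s - (W2 q + C * v q) * C / s ^ 2
  | i2, i2, i2 => (W22 q + C * v2 q) / s
  end.
Proof.
intros Hq; cbv zeta.
rewrite (partial_ext_regular j _ _ q (cov_sph k i) Hq).
destruct (Dv q) as [d1 d2], (DW q) as [d3 d4], (Dv1 q) as [d5 d6],
  (Dv2 q) as [d7 d8], (DW1 q) as [d9 d10], (DW2 q) as [d11 d12].
destruct q as [phi theta]; unfold regular in Hq; simpl in *.
assert (Dcos := is_derive_cos phi).
assert (Dinv := is_derive_inv_sin phi Hq).
assert (Dcot := is_derive_cot phi Hq).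
assert (Dc : forall a x : R, is_derive (fun _ : R => a) x 0)
  by (intros; apply @is_derive_const).
destruct k, i, j; simpl; apply is_derive_unique; trivial.
- apply (is_derive_ext (fun r => 1 * v2 (r, theta) + - cos r * W (r, theta))).
    intros; simpl; ring.
  evar_last; [apply is_derive_combination; [apply Dc
    | apply (is_derive_opp cos), Dcos | exact d7 | exact d3]|].
  unfold opp; simpl; ring.
- apply (is_derive_ext (fun r => 1 * v2 (phi, r) + - cos phi * W (phi, r))).
    intros; simpl; ring.
  evar_last; [apply is_derive_combination; [apply Dc | apply Dc | exact d8 | exact d4]|].
  simpl; ring.
- apply (is_derive_ext (fun r => / sin r * W1 (r, theta))).
    intros; simpl; apply Rmult_comm.
  evar_last; [apply is_derive_mult_R; [exact Dinv | exact d9]|].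
  simpl; field; exact Hq.
- apply (is_derive_ext (fun r => / sin phi * W1 (phi, r))).
    intros; simpl; apply Rmult_comm.
  evar_last; [apply is_derive_scal; exact d10|].
  simpl; field; exact Hq.
- apply (is_derive_ext_loc
    (fun r => / sin r * W2 (r, theta) + cos r / sin r * v (r, theta))).
    generalize (regular_near phi theta Hq); apply filter_imp; unfold regular; simpl.
    intros r Hr; field; exact Hr.
  evar_last; [apply is_derive_combination; [exact Dinv | exact Dcot | exact d11 | exact d1]|].
  simpl; field; exact Hq.
- apply (is_derive_ext
    (fun r => / sin phi * W2 (phi, r) + cos phi / sin phi * v (phi, r))).
    intros r; simpl; field; exact Hq.
  evar_last; [apply is_derive_combination; [apply Dc | apply Dc | exact d12 | exact d2]|].
  simpl; field; exact Hq.
Qed.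

(** The scalar product of Lw with (v, y) is the divergence of S applied to (v, y)
minus S contracted with the gradient of (v, y).  Here [tau] is s times the
off-diagonal entry of S.  The entries of S do not depend on [c] because the
rotation of angular velocity [c] is isometric.  The sum of squares in the last
line is half of |S|^2. *)
Lemma viscous_balance (c : R) q : regular q ->
  let s := sin (fst q) in let C := cos (fst q) in
  let y := W q - c * s in
  let tau := s * W1 q - C * W q + v2 q in
  s * (v q * Lop sph w i1 q + s * y * Lop sph w i2 q) =
    (2 * C * v1 q * v q + 2 * s * v11 q * v q + 2 * s * v1 q ^ 2
     + (s * W11 q + s * W q + v21 q) * y + tau * (W1 q - c * C))
    + ((s * W12 q - C * W2 q + v22 q) * v q + tau * v2 q
     + 2 * (W22 q + C * v2 q) * y + 2 * (W2 q + C * v q) * W2 q) / s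
    - s * (2 * v1 q ^ 2 + (tau / s) ^ 2 + 2 * ((W2 q + C * v q) / s) ^ 2).
Proof.
intros Hq; cbv zeta; unfold Lop, cov2, sum2.
rewrite !partial_cov_sph, !cov_sph, !Christoffel_sph by trivial.
rewrite !ginv_sph by trivial.
unfold regular in Hq; cbv zeta.
set (s := sin (fst q)) in *; set (C := cos (fst q)).
field; exact Hq.
Qed.

Variables p p1 p2 : R2 -> R.
Hypothesis Dp : has_partials p p1 p2.

Lemma gradient_sph (k : idx) q : regular q -> gradient sph p k q =
  match k with i1 => p1 q | i2 => p2 q / sin (fst q) ^ 2 end.
Proof.
intros Hq; unfold gradient, sum2; rewrite !ginv_sph by trivial.
assert (P1 : partial i1 p q = p1 q) by (apply is_derive_unique, Dp).
assert (P2 : partial i2 p q = p2 q) by (apply is_derive_unique, Dp).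
rewrite P1, P2; destruct k; field; exact Hq.
Qed.

(** The terms in [Q], [Q1] and [Q2] form s times the divergence of [Q] times the
velocity; the term with [c] next to the zonal derivative of the pressure is there
because the equation is tested with y instead of W. *)
Lemma energy_balance (mu omega c vt Wt : R) q :
  let s := sin (fst q) in let C := cos (fst q) in
  let y := W q - c * s in
  let tau := s * W1 q - C * W q + v2 q in
  let Q := (v q ^ 2 + y ^ 2) / 2 + p q + (omega * c - c ^ 2 / 2) * s ^ 2 in
  let Q1 := v q * v1 q + y * (W1 q - c * C) + p1 q + (2 * omega * c - c ^ 2) * (s * C) in
  let Q2 := v q * v2 q + y * W2 q + p2 q in
  0 < s ->
  vt + nabla sph w w i1 q - mu * Lop sph w i1 q + 2 * omega * C * Kop sph w i1 q
    + gradient sph p i1 q = 0 ->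
  Wt / s + nabla sph w w i2 q - mu * Lop sph w i2 q + 2 * omega * C * Kop sph w i2 q
    + gradient sph p i2 q = 0 ->
  divergence sph w q = 0 ->
  s * (v q * vt + y * Wt) =
    (mu * (2 * C * v1 q * v q + 2 * s * v11 q * v q + 2 * s * v1 q ^ 2
       + (s * W11 q + s * W q + v21 q) * y + tau * (W1 q - c * C))
     - (C * v q * Q + s * v1 q * Q + s * v q * Q1))
    + (mu * (((s * W12 q - C * W2 q + v22 q) * v q + tau * v2 q
       + 2 * (W22 q + C * v2 q) * y + 2 * (W2 q + C * v q) * W2 q) / s)
     - (W2 q * Q + W q * Q2 - c * s * p2 q))
    - mu * (s * (2 * v1 q ^ 2 + (tau / s) ^ 2 + 2 * ((W2 q + C * v q) / s) ^ 2)).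
Proof.
cbv zeta; intros Hs; assert (Hq : regular q) by (unfold regular; lra).
assert (Hs' : 0 <= sin (fst q)) by lra.
pose proof (viscous_balance c q Hq) as HL; cbv zeta in HL.
rewrite divergence_sph, !nabla_sph, !Kop_sph, !gradient_sph by trivial.
set (L1 := Lop sph w i1 q) in *; set (L2 := Lop sph w i2 q) in *.
clearbody L1 L2; unfold regular in Hq.
set (s := sin (fst q)) in *; set (C := cos (fst q)) in *.
intros E1 E2 E3.
apply Rminus_diag_uniq.
match type of E1 with ?e1 = _ => match type of E2 with ?e2 = _ =>
  match type of E3 with ?e3 = _ => match type of HL with ?l = ?r =>
  transitivity (s * v q * e1 + s * s * (W q - c * s) * e2
    + s * ((v q ^ 2 + (W q - c * s) ^ 2) / 2 + p q + (omega * c - c ^ 2 / 2) * s ^ 2) * e3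
    + mu * (l - r)) end end end end.
(* The identity is a combination of the two momentum equations, tested with
   (v, y), of the divergence equation times [Q] and of the viscous balance. *)
- field; exact Hq.
- rewrite E1, E2, E3, HL; ring.
Qed.

End SphericalComponents.

(** * Integrals depending on a parameter *)

(** The tube lemma: continuity at every point of a compact segment gives an
estimate that is uniform along it. *)
Lemma uniform_near_segment {T : UniformSpace} (f : T -> R -> R) (x0 : T) (a b eps : R) :
  0 < eps ->
  (forall y, a <= y <= b -> continuous (fun z : T * R => f (fst z) (snd z)) (x0, y)) ->
  locally x0 (fun x => forall y, a <= y <= b -> Rabs (f x y - f x0 y) < eps).
Proof.
intros Heps Hf.
assert (He : 0 < eps / 2) by lra.
assert (H : forall y, exists d : posreal, a <= y <= b ->
  forall x y', ball x0 d x -> Rabs (y' - y) < d -> Rabs (f x y' - f x0 y) < eps / 2).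
{ intros y; destruct (classic (a <= y <= b)) as [Hy|Hy].
  - destruct (Hf y Hy (ball (f x0 y) (mkposreal _ He))) as [d Hd].
      apply locally_ball.
    exists d; intros _ x y' Hx Hy'; apply (Hd (x, y')); now split.
  - exists (mkposreal 1 Rlt_0_1); intros; contradiction. }
pose (delta := fun y => proj1_sig (constructive_indefinite_description _ (H y))).
assert (Hdelta : forall y, a <= y <= b -> forall x y', ball x0 (delta y) x ->
    Rabs (y' - y) < delta y -> Rabs (f x y' - f x0 y) < eps / 2).
{ intros y; unfold delta; now destruct constructive_indefinite_description. }
destruct (compactness_value_1d a b delta) as [d Hd].
exists d; intros x Hx y Hy.
apply Rnot_le_lt; intros Habs; apply (Hd y Hy); intros [s (Hs & Hys & Hds)].
apply Rle_not_lt in Habs; apply Habs.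
assert (H1 := Hdelta s Hs x y (ball_le _ _ _ Hds _ Hx) Hys).
assert (H2 := Hdelta s Hs x0 y (ball_center _ _) Hys).
apply Rabs_def2 in H1, H2; apply Rabs_def1; lra.
Qed.

Lemma continuous_RInt_param {T : UniformSpace} (f : T -> R -> R) (x0 : T) (a b : R) :
  a <= b ->
  (forall y, a <= y <= b -> continuous (fun z : T * R => f (fst z) (snd z)) (x0, y)) ->
  locally x0 (fun x => ex_RInt (f x) a b) ->
  continuous (fun x => RInt (f x) a b) x0.
Proof.
intros Hab Hf Hi; apply filterlim_locally; intros eps.
assert (He : 0 < eps / (b - a + 1)) by (apply Rdiv_lt_0_compat; [apply cond_pos | lra]).
generalize (filter_and _ _ Hi (uniform_near_segment f x0 a b _ He Hf)).
apply filter_imp; intros x [Hx Hu].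
change (Rabs (RInt (f x) a b - RInt (f x0) a b) < eps).
assert (H0 := locally_singleton _ _ Hi); simpl in H0.
assert (E : RInt (fun y => f x y - f x0 y) a b = RInt (f x) a b - RInt (f x0) a b)
  by exact (RInt_minus (f x) (f x0) a b Hx H0).
rewrite <- E.
apply Rle_lt_trans with ((b - a) * (eps / (b - a + 1))).
- apply abs_RInt_le_const; trivial.
    exact (ex_RInt_minus (f x) (f x0) a b Hx H0).
  intros y Hy; left; now apply Hu.
- apply Rlt_le_trans with ((b - a + 1) * (eps / (b - a + 1))).
    apply Rmult_lt_compat_r; lra.
  right; field; lra.
Qed.

Lemma ex_RInt_all_continuous (f : R -> R) (a b : R) :
  (forall x, continuous f x) -> ex_RInt f a b.
Proof. intros H; apply (ex_RInt_continuous (V := R_CompleteNormedModule)); auto. Qed.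

Lemma is_derive_RInt_under (J : R -> Prop) (f f' : R -> R -> R) (a b t : R) :
  a <= b -> open J -> J t ->
  (forall s y, J s -> is_derive (fun u => f u y) s (f' s y)) ->
  (forall y, continuous (fun z : R * R => f' (fst z) (snd z)) (t, y)) ->
  (forall s y, J s -> continuous (f s) y) ->
  is_derive (fun s => RInt (f s) a b) t (RInt (f' t) a b).
Proof.
intros Hab HJ Ht Hd Hc Hi.
assert (E : RInt (f' t) a b = RInt (fun y => Derive (fun u => f u y) t) a b).
{ apply RInt_ext; intros y _; symmetry; now apply is_derive_unique, Hd. }
rewrite E.
apply (is_derive_RInt_param f).
- generalize (HJ t Ht); apply filter_imp; intros s Hs y _; eexists; now apply Hd.
- intros y _; apply continuity_2d_pt_filterlim.
  apply (continuous_ext_loc (fun z : R * R => Derive (fun u => f u (snd z)) (fst z))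
    (fun z : R * R => f' (fst z) (snd z)) (t, y)); [| apply Hc].
  assert (HJ' : locally (t, y) (fun z : R * R => J (fst z))).
    now apply (continuous_fst (t : R_UniformSpace) (y : R_UniformSpace)), HJ.
  revert HJ'; apply filter_imp; intros [s y'] Hs; symmetry.
  now apply is_derive_unique, Hd.
- generalize (HJ t Ht); apply filter_imp; intros s Hs.
  apply ex_RInt_all_continuous; intros y; now apply Hi.
Qed.

Lemma continuous_slice_r (f : R -> R -> R) (x y : R) :
  continuous (fun z : R * R => f (fst z) (snd z)) (x, y) -> continuous (f x) y.
Proof.
intros H; apply (continuous_comp (fun y : R => (x, y)) (fun z => f (fst z) (snd z)));
  trivial.
apply continuous_pair; [apply continuous_const | apply continuous_id].
Qed.

(** The form of the divergence theorem that suits spherical coordinates: the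
flux [F] in the first variable vanishes at both ends, while the flux [B] in the
second one is periodic and need only exist inside the interval, without any
bound near its ends. *)
Lemma RInt_flux_nonpos (a b c d : R) (E F F' B B' : R -> R -> R) :
  a <= b -> c <= d ->
  (forall x y, continuous (fun z : R * R => E (fst z) (snd z)) (x, y)) ->
  (forall x y, continuous (fun z : R * R => F' (fst z) (snd z)) (x, y)) ->
  (forall x y, continuous (F x) y) ->
  (forall x y, is_derive (fun u => F u y) x (F' x y)) ->
  (forall y, F a y = 0) -> (forall y, F b y = 0) ->
  (forall x y, a < x < b -> is_derive (B x) y (B' x y)) ->
  (forall x y, a < x < b -> continuous (B' x) y) ->
  (forall x, a < x < b -> B x d = B x c) ->
  (forall x y, a < x < b -> E x y <= F' x y + B' x y) ->
  RInt (fun x => RInt (E x) c d) a b <= 0.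
Proof.
intros Hab Hcd CE CF' CF DF Fa Fb DB CB PB Hle.
assert (Ei : forall x, ex_RInt (E x) c d)
  by (intros x; apply ex_RInt_all_continuous; intros y; now apply continuous_slice_r).
assert (F'i : forall x, ex_RInt (F' x) c d)
  by (intros x; apply ex_RInt_all_continuous; intros y; now apply continuous_slice_r).
assert (CIE : forall x, continuous (fun x => RInt (E x) c d) x)
  by (intros x; apply continuous_RInt_param; trivial; now apply filter_forall).
assert (CIF' : forall x, continuous (fun x => RInt (F' x) c d) x)
  by (intros x; apply continuous_RInt_param; trivial; now apply filter_forall).
assert (DG : forall x, is_derive (fun x => RInt (F x) c d) x (RInt (F' x) c d)).
{ intros x; apply (is_derive_RInt_under (fun _ => True)); auto; apply open_true. }
assert (HG : RInt (fun x => RInt (F' x) c d) a b = 0).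
{ transitivity (RInt (F b) c d - RInt (F a) c d).
  - apply is_RInt_unique.
    apply (is_RInt_derive (fun x => RInt (F x) c d)); intros; trivial.
  - rewrite (RInt_ext (F b) (F a)) by (intros; now rewrite Fa, Fb).
    apply Rminus_diag. }
(* For each inner [x] the integral of [B'] vanishes by periodicity, so that the
   inner integral of [E] is at most the derivative of the integral of [F]. *)
rewrite <- HG; apply RInt_le; trivial; try (now apply ex_RInt_all_continuous).
intros x Hx.
assert (HB : is_RInt (B' x) c d (B x d - B x c)).
{ apply (is_RInt_derive (B x)); auto. }
rewrite (PB x Hx), Rminus_diag in HB.
assert (HS : is_RInt (fun y => F' x y + B' x y) c d (RInt (F' x) c d + 0)).
{ apply (is_RInt_plus (F' x)); trivial; now apply (RInt_correct (F' x)). }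
rewrite Rplus_0_r in HS.
apply (is_RInt_le (E x) (fun y => F' x y + B' x y) c d); trivial; [| now auto].
now apply (RInt_correct (E x)).
Qed.

Lemma continuous_uncurry (J : R -> Prop) (e : R * (R * R) -> R) s x y :
  smooth (fun z : R * (R * R) => J (fst z)) e -> J s ->
  continuous (fun z : (R * R) * R => e (fst (fst z), (snd (fst z), snd z))) ((s, x), y).
Proof.
intros Se Hs.
apply (continuous_comp (fun z : (R * R) * R => (fst (fst z), (snd (fst z), snd z))) e).
- repeat apply continuous_pair.
  + apply (continuous_comp fst fst); apply continuous_fst.
  + apply (continuous_comp fst snd); [apply continuous_fst | apply continuous_snd].
  + apply continuous_snd.
- exact (smooth_continuous _ e (s, (x, y)) Se Hs).
Qed.

Lemma continuous_slice_phi (J : R -> Prop) (e : R * (R * R) -> R) s x y :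
  smooth (fun z : R * (R * R) => J (fst z)) e -> J s ->
  continuous (fun z : R * R => e (s, (fst z, snd z))) (x, y).
Proof.
intros Se Hs; apply (continuous_comp (fun z : R * R => (s, (fst z, snd z))) e).
- repeat apply continuous_pair;
    [apply continuous_const | apply continuous_fst | apply continuous_snd].
- exact (smooth_continuous _ e (s, (x, y)) Se Hs).
Qed.

Lemma continuous_slice_theta (J : R -> Prop) (e : R * (R * R) -> R) s x y :
  smooth (fun z : R * (R * R) => J (fst z)) e -> J s ->
  continuous (fun y => e (s, (x, y))) y.
Proof.
intros Se Hs; apply (continuous_slice_r (fun x y => e (s, (x, y)))).
now apply (continuous_slice_phi J).
Qed.

Lemma is_derive_RInt2 (J : R -> Prop) (e : R * (R * R) -> R) (a b c d t : R) :
  a <= b -> c <= d -> open J -> J t ->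
  smooth (fun z : R * (R * R) => J (fst z)) e ->
  is_derive (fun s => RInt (fun x => RInt (fun y => e (s, (x, y))) c d) a b) t
    (RInt (fun x => RInt (fun y => dirD et e (t, (x, y))) c d) a b).
Proof.
intros Hab Hcd HJ Ht Se.
assert (Se' := smooth_dirD _ e et Se).
assert (EI : forall s x (e : R * (R * R) -> R),
    smooth (fun z : R * (R * R) => J (fst z)) e -> J s ->
    ex_RInt (fun y => e (s, (x, y))) c d).
{ intros s x e' S Hs; apply ex_RInt_all_continuous; intros y.
  now apply (continuous_slice_theta J). }
apply (is_derive_RInt_under J (fun s x => RInt (fun y => e (s, (x, y))) c d)
  (fun s x => RInt (fun y => dirD et e (s, (x, y))) c d)); trivial.
- intros s x Hs.
  apply (is_derive_RInt_under J (fun s y => e (s, (x, y)))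
    (fun s y => dirD et e (s, (x, y)))); trivial.
  + intros s' y Hs'; now apply (is_derive_t (fun z => J (fst z))).
  + intros y.
    apply (continuous_comp (fun z : R * R => (fst z, (x, snd z))) (dirD et e)).
    * repeat apply continuous_pair;
        [apply continuous_fst | apply continuous_const | apply continuous_snd].
    * exact (smooth_continuous _ _ (s, (x, y)) Se' Hs).
  + intros s' y Hs'; now apply (continuous_slice_theta J).
- intros x.
  apply (continuous_RInt_param (fun (z : R * R) y => dirD et e (fst z, (snd z, y))));
    trivial.
  + intros y _; now apply (continuous_uncurry J).
  + assert (HJ' : locally (t, x) (fun z : R * R => J (fst z))).
      now apply (continuous_fst (t : R_UniformSpace) (x : R_UniformSpace)), HJ.
    revert HJ'; apply filter_imp; intros z Hz; now apply EI.
- intros s x Hs.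
  apply (continuous_RInt_param (fun x y => e (s, (x, y)))); trivial.
  + intros y _; now apply (continuous_slice_phi J).
  + apply filter_forall; intros; now apply EI.
Qed.

(** * Energy fluxes *)

Lemma Derive_eta (f : R -> R) (x l : R) :
  is_derive f x l -> Derive (fun r => f r) x = l.
Proof. exact (is_derive_unique f x l). Qed.

Section Fluxes.

Variables mu omega c : R.

(** Twice the fluxes of [energy_balance], as functions of the values of sin phi,
cos phi, the components, their derivatives and the pressure.  The zonal flux
is split so that its singular factor 1 / sin phi stays outside. *)
Definition meridional_flux (s C v W v1 W1 v2 p : R) : R :=
  let y := W - c * s in
  2 * (mu * (2 * s * v1 * v + (s * W1 - C * W + v2) * y)
   - s * v * ((v ^ 2 + y ^ 2) / 2 + p + (omega * c - c ^ 2 / 2) * s ^ 2)).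

Definition zonal_flux_inertial (s W v p : R) : R :=
  let y := W - c * s in
  - 2 * (W * ((v ^ 2 + y ^ 2) / 2 + p + (omega * c - c ^ 2 / 2) * s ^ 2) - c * s * p).

Definition zonal_flux_viscous (s C v W W1 v2 W2 : R) : R :=
  2 * mu * ((s * W1 - C * W + v2) * v + 2 * (W2 + C * v) * (W - c * s)).

Lemma is_derive_meridional_flux (v W v1 W1 v2 p : R -> R) (phi dv1 dW1 dv2 dp : R) :
  is_derive v phi (v1 phi) -> is_derive W phi (W1 phi) ->
  is_derive v1 phi dv1 -> is_derive W1 phi dW1 -> is_derive v2 phi dv2 ->
  is_derive p phi dp ->
  let s := sin phi in let C := cos phi in
  let y := W phi - c * s in
  let tau := s * W1 phi - C * W phi + v2 phi in
  let Q := (v phi ^ 2 + y ^ 2) / 2 + p phi + (omega * c - c ^ 2 / 2) * s ^ 2 in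
  let Q1 := v phi * v1 phi + y * (W1 phi - c * C) + dp
    + (2 * omega * c - c ^ 2) * (s * C) in
  is_derive (fun r => meridional_flux (sin r) (cos r) (v r) (W r) (v1 r) (W1 r) (v2 r) (p r)) phi
    (2 * (mu * (2 * C * v1 phi * v phi + 2 * s * dv1 * v phi + 2 * s * v1 phi ^ 2
       + (s * dW1 + s * W phi + dv2) * y + tau * (W1 phi - c * C))
     - (C * v phi * Q + s * v1 phi * Q + s * v phi * Q1))).
Proof.
intros Hv HW Hv1 HW1 Hv2 Hp; cbv zeta; unfold meridional_flux.
auto_derive.
  repeat split; eexists; eassumption.
rewrite (Derive_eta _ _ _ Hv), (Derive_eta _ _ _ HW),
  (Derive_eta _ _ _ Hv1), (Derive_eta _ _ _ HW1),
  (Derive_eta _ _ _ Hv2), (Derive_eta _ _ _ Hp).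
field.
Qed.

Lemma is_derive_zonal_flux (s C : R) (v W W1 v2 W2 p : R -> R)
    (theta dW1 dv2 dW2 dp : R) : s <> 0 ->
  is_derive v theta (v2 theta) -> is_derive W theta (W2 theta) ->
  is_derive W1 theta dW1 -> is_derive v2 theta dv2 -> is_derive W2 theta dW2 ->
  is_derive p theta dp ->
  let y := W theta - c * s in
  let tau := s * W1 theta - C * W theta + v2 theta in
  let Q := (v theta ^ 2 + y ^ 2) / 2 + p theta + (omega * c - c ^ 2 / 2) * s ^ 2 in
  let Q2 := v theta * v2 theta + y * W2 theta + dp in
  is_derive (fun r => zonal_flux_inertial s (W r) (v r) (p r)
      + / s * zonal_flux_viscous s C (v r) (W r) (W1 r) (v2 r) (W2 r)) theta
    (2 * (mu * (((s * dW1 - C * W2 theta + dv2) * v theta + tau * v2 theta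
       + 2 * (dW2 + C * v2 theta) * y
       + 2 * (W2 theta + C * v theta) * W2 theta) / s)
     - (W2 theta * Q + W theta * Q2 - c * s * dp))).
Proof.
intros Hs Hv HW HW1 Hv2 HW2 Hp; cbv zeta; unfold zonal_flux_inertial, zonal_flux_viscous.
auto_derive.
  repeat split; eexists; eassumption.
rewrite (Derive_eta _ _ _ Hv), (Derive_eta _ _ _ HW),
  (Derive_eta _ _ _ HW1), (Derive_eta _ _ _ Hv2),
  (Derive_eta _ _ _ HW2), (Derive_eta _ _ _ Hp).
field; exact Hs.
Qed.

End Fluxes.

Lemma dirD_translate {V : NormedModule R_AbsRing} (f : V -> R) (P v : V) :
  (forall x, f (plus x P) = f x) -> forall x, dirD v f (plus x P) = dirD v f x.
Proof.
intros Hf x; apply Derive_ext; intros s.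
now rewrite <- plus_assoc, (plus_comm P), plus_assoc, Hf.
Qed.

(** * Decay of the energy *)

Lemma is_derive_inj (f : R -> R) (x l1 l2 : R) :
  is_derive f x l1 -> is_derive f x l2 -> l1 = l2.
Proof.
intros H1 H2; apply is_derive_unique in H1, H2; now rewrite <- H1, <- H2.
Qed.

Definition turn : R * (R * R) := (0, (0, 2 * PI)).

Lemma plus_turn (t phi theta : R) :
  plus (t, (phi, theta)) turn = (t, (phi, theta + 2 * PI)).
Proof.
unfold turn; do 3 (unfold prod_plus, plus; simpl).
now rewrite !Rplus_0_r.
Qed.

(** The data are the components of a solution on the whole coordinate plane; the
momentum equations are stated where the coordinates are an oriented chart. *)
Section EnergyDecay.

Variables (J : R -> Prop) (mu omega c t : R).
Variables v W p : R * (R * R) -> R.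
Variable w : idx -> R2 -> R.
Let D (x : R * (R * R)) : Prop := J (fst x).

Hypothesis HJ : open J.
Hypothesis Ht : J t.
Hypothesis Hmu : 0 < mu.
Hypotheses (Sv : smooth D v) (SW : smooth D W) (Sp : smooth D p).
Hypothesis Ev : forall q, regular q -> w i1 q = v (t, q).
Hypothesis EW : forall q, regular q -> w i2 q = W (t, q) / sin (fst q).
Hypothesis E1 : forall q : R2, 0 < fst q < PI ->
  dirD et v (t, q) + nabla sph w w i1 q - mu * Lop sph w i1 q
  + 2 * omega * cos (fst q) * Kop sph w i1 q
  + gradient sph (fun r => p (t, r)) i1 q = 0.
Hypothesis E2 : forall q : R2, 0 < fst q < PI ->
  dirD et W (t, q) / sin (fst q) + nabla sph w w i2 q - mu * Lop sph w i2 q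
  + 2 * omega * cos (fst q) * Kop sph w i2 q
  + gradient sph (fun r => p (t, r)) i2 q = 0.
Hypothesis E3 : forall q : R2, 0 < fst q < PI -> divergence sph w q = 0.

Hypothesis Pv : forall x, v (plus x turn) = v x.
Hypothesis PW : forall x, W (plus x turn) = W x.
Hypothesis Pp : forall x, p (plus x turn) = p x.

(* The field is a fixed vector at a pole, where moving along theta only rotates
   the frame. *)
Hypothesis north : forall theta : R, dirD etheta v (t, (0, theta)) = W (t, (0, theta)).
Hypothesis south : forall theta : R, dirD etheta v (t, (PI, theta)) = - W (t, (PI, theta)).

Let HD : open D := open_time J HJ.

Lemma smooth_pow2 f : smooth D f -> smooth D (fun x => f x ^ 2).
Proof.
intros Sf; apply (smooth_ext D (fun x => f x * f x)); trivial.
  intros; ring.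
now apply smooth_mult.
Qed.

Let Ssin : smooth D (fun x => sin (fst (snd x))) :=
  proj1 (smooth_sin_cos_linear D _ HD is_linear_phi).
Let Scos : smooth D (fun x => cos (fst (snd x))) :=
  proj2 (smooth_sin_cos_linear D _ HD is_linear_phi).

Ltac prove_smooth := repeat first
  [ exact Sv | exact SW | exact Sp | exact Ssin | exact Scos
  | apply smooth_const
  | refine (smooth_dirD D _ _ _)
  | refine (smooth_minus D _ _ HD _ _)
  | refine (smooth_plus D _ _ HD _ _)
  | refine (smooth_mult D _ _ HD _ _)
  | refine (smooth_pow2 _ _) ].

(** The squared norm of u - u^K times the density of the volume form. *)
Definition density (x : R * (R * R)) : R :=
  (v x ^ 2 + (W x - c * sin (fst (snd x))) ^ 2) * sin (fst (snd x)).

Lemma smooth_density : smooth D density.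
Proof. unfold density; prove_smooth. Qed.

Definition meridional (x : R * (R * R)) : R :=
  meridional_flux mu omega c (sin (fst (snd x))) (cos (fst (snd x))) (v x) (W x)
    (dirD ephi v x) (dirD ephi W x) (dirD etheta v x) (p x).

Lemma smooth_meridional : smooth D meridional.
Proof. unfold meridional, meridional_flux; cbv zeta; prove_smooth. Qed.

Definition zonal_inertial (x : R * (R * R)) : R :=
  zonal_flux_inertial omega c (sin (fst (snd x))) (W x) (v x) (p x).

Lemma smooth_zonal_inertial : smooth D zonal_inertial.
Proof. unfold zonal_inertial, zonal_flux_inertial; cbv zeta; prove_smooth. Qed.

Definition zonal_viscous (x : R * (R * R)) : R :=
  zonal_flux_viscous mu c (sin (fst (snd x))) (cos (fst (snd x))) (v x) (W x)
    (dirD ephi W x) (dirD etheta v x) (dirD etheta W x).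

Lemma smooth_zonal_viscous : smooth D zonal_viscous.
Proof. unfold zonal_viscous, zonal_flux_viscous; cbv zeta; prove_smooth. Qed.

Lemma slice_partials f : smooth D f ->
  has_partials (fun q => f (t, q)) (fun q => dirD ephi f (t, q))
    (fun q => dirD etheta f (t, q)).
Proof.
intros Sf [phi theta]; split;
  [now apply (is_derive_phi D) | now apply (is_derive_theta D)].
Qed.

Lemma dirD_density (phi theta : R) : dirD et density (t, (phi, theta)) =
  2 * (sin phi * (v (t, (phi, theta)) * dirD et v (t, (phi, theta))
    + (W (t, (phi, theta)) - c * sin phi) * dirD et W (t, (phi, theta)))).
Proof.
rewrite <- (is_derive_unique _ _ _
  (is_derive_t D density smooth_density t phi theta Ht)).
assert (Hv := is_derive_t D v Sv t phi theta Ht).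
assert (HW := is_derive_t D W SW t phi theta Ht).
apply is_derive_unique; unfold density; simpl.
set (v' := fun s : R => v (s, (phi, theta))).
set (W' := fun s : R => W (s, (phi, theta))).
apply (is_derive_ext (fun s : R => (v' s ^ 2 + (W' s - c * sin phi) ^ 2) * sin phi)).
  reflexivity.
auto_derive; [repeat split; eexists; eassumption|].
rewrite (Derive_eta v' _ _ Hv), (Derive_eta W' _ _ HW); unfold v', W'; ring.
Qed.

Lemma density_rate_le (phi theta : R) : 0 < phi < PI ->
  dirD et density (t, (phi, theta)) <=
  dirD ephi meridional (t, (phi, theta))
  + (dirD etheta zonal_inertial (t, (phi, theta))
     + / sin phi * dirD etheta zonal_viscous (t, (phi, theta))).
Proof.
intros Hphi.
assert (Hs : 0 < sin phi) by (apply sin_gt_0; apply Hphi).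
pose proof (energy_balance w _ _ _ _ _ _ Ev EW (slice_partials v Sv)
  (slice_partials W SW) _ _ _ _ _ _ _ _
  (slice_partials _ (smooth_dirD D v ephi Sv))
  (slice_partials _ (smooth_dirD D v etheta Sv))
  (slice_partials _ (smooth_dirD D W ephi SW))
  (slice_partials _ (smooth_dirD D W etheta SW))
  _ _ _ (slice_partials p Sp) mu omega c _ _ (phi, theta) Hs
  (E1 (phi, theta) Hphi) (E2 (phi, theta) Hphi) (E3 (phi, theta) Hphi)) as HE.
cbv zeta in HE; simpl fst in HE; simpl snd in HE.
rewrite dirD_density.
refine (Rle_trans _ _ _ (Req_le _ _ (f_equal (Rmult 2) HE)) _); clear HE.
pose proof (fun f Sf => is_derive_phi D f Sf t phi theta Ht) as d1.
pose proof (fun f Sf => is_derive_theta D f Sf t phi theta Ht) as d2.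
rewrite (is_derive_inj _ phi _ _ (d1 meridional smooth_meridional)
  (is_derive_meridional_flux mu omega c
  (fun r : R => v (t, (r, theta))) (fun r : R => W (t, (r, theta)))
  (fun r : R => dirD ephi v (t, (r, theta))) (fun r : R => dirD ephi W (t, (r, theta)))
  (fun r : R => dirD etheta v (t, (r, theta))) (fun r : R => p (t, (r, theta))) phi
  _ _ _ _ (d1 v Sv) (d1 W SW) (d1 _ (smooth_dirD D v ephi Sv))
  (d1 _ (smooth_dirD D W ephi SW)) (d1 _ (smooth_dirD D v etheta Sv)) (d1 p Sp))).
assert (H2 : is_derive (fun r : R => zonal_inertial (t, (phi, r))
    + / sin phi * zonal_viscous (t, (phi, r)))
  theta (dirD etheta zonal_inertial (t, (phi, theta))
    + / sin phi * dirD etheta zonal_viscous (t, (phi, theta)))).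
{ apply (is_derive_plus (fun r : R => zonal_inertial (t, (phi, r))));
    [exact (d2 _ smooth_zonal_inertial)|].
  apply (is_derive_scal (fun r : R => zonal_viscous (t, (phi, r))));
  exact (d2 _ smooth_zonal_viscous). }
rewrite (is_derive_inj _ _ _ _ H2 (is_derive_zonal_flux mu omega c (sin phi) (cos phi)
  (fun r : R => v (t, (phi, r))) (fun r : R => W (t, (phi, r)))
  (fun r : R => dirD ephi W (t, (phi, r))) (fun r : R => dirD etheta v (t, (phi, r)))
  (fun r : R => dirD etheta W (t, (phi, r))) (fun r : R => p (t, (phi, r))) theta
  _ _ _ _ (Rgt_not_eq _ _ Hs) (d2 v Sv) (d2 W SW) (d2 _ (smooth_dirD D W ephi SW))
  (d2 _ (smooth_dirD D v etheta Sv)) (d2 _ (smooth_dirD D W etheta SW)) (d2 p Sp))).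
cbv zeta beta.
match goal with |- 2 * (?a + ?b - mu * (sin phi * ?N)) <= 2 * ?a' + 2 * ?b' =>
  change a' with a; change b' with b;
  assert (0 <= mu * (sin phi * N)); [| lra] end.
apply Rmult_le_pos; [lra|]; apply Rmult_le_pos; [lra|].
repeat apply Rplus_le_le_0_compat; try (apply Rmult_le_pos; [lra|]); apply pow2_ge_0.
Qed.

Lemma energy_rate_nonpos :
  RInt (fun phi : R => RInt (fun theta : R => dirD et density (t, (phi, theta))) 0 (2 * PI))
    0 PI <= 0.
Proof.
assert (HPI := PI_RGT_0).
apply (RInt_flux_nonpos 0 PI 0 (2 * PI)
  (fun phi theta : R => dirD et density (t, (phi, theta)))
  (fun phi theta : R => meridional (t, (phi, theta)))
  (fun phi theta : R => dirD ephi meridional (t, (phi, theta)))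
  (fun phi theta : R => zonal_inertial (t, (phi, theta))
     + / sin phi * zonal_viscous (t, (phi, theta)))
  (fun phi theta : R => dirD etheta zonal_inertial (t, (phi, theta))
     + / sin phi * dirD etheta zonal_viscous (t, (phi, theta)))); try lra.
- intros x y; apply (continuous_slice_phi J); trivial.
  exact (smooth_dirD D _ et smooth_density).
- intros x y; apply (continuous_slice_phi J); trivial.
  exact (smooth_dirD D _ ephi smooth_meridional).
- intros x y; apply (continuous_slice_theta J); trivial; exact smooth_meridional.
- intros x y; exact (is_derive_phi D meridional smooth_meridional t x y Ht).
- intros y; unfold meridional, meridional_flux; simpl; rewrite sin_0, cos_0, north; ring.
- intros y; unfold meridional, meridional_flux; simpl; rewrite sin_PI, cos_PI, south; ring.
- intros x y _; apply (is_derive_plus (fun r : R => zonal_inertial (t, (x, r)))).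
    exact (is_derive_theta D _ smooth_zonal_inertial t x y Ht).
  apply (is_derive_scal (fun r : R => zonal_viscous (t, (x, r)))).
  exact (is_derive_theta D _ smooth_zonal_viscous t x y Ht).
- intros x y _; apply (continuous_plus (fun y : R => dirD etheta zonal_inertial (t, (x, y)))).
    apply (continuous_slice_theta J); trivial;
    exact (smooth_dirD D _ etheta smooth_zonal_inertial).
  apply (continuous_scal_r (/ sin x) (fun y : R => dirD etheta zonal_viscous (t, (x, y)))).
  apply (continuous_slice_theta J); trivial;
    exact (smooth_dirD D _ etheta smooth_zonal_viscous).
- intros x _.
  assert (E : forall f : R * (R * R) -> R, (forall x, f (plus x turn) = f x) ->
      f (t, (x, 2 * PI)) = f (t, (x, 0))).
  { intros f Hf; rewrite <- (Hf (t, (x, 0))), plus_turn; now rewrite Rplus_0_l. }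
  unfold zonal_inertial, zonal_viscous; simpl.
  rewrite (E v Pv), (E W PW), (E p Pp), (E _ (dirD_translate v turn etheta Pv)),
    (E _ (dirD_translate W turn etheta PW)), (E _ (dirD_translate W turn ephi PW)).
  reflexivity.
- intros x y Hx; now apply density_rate_le.
Qed.

End EnergyDecay.

(** * The spherical chart and the components of the solution *)

Lemma cos_eq_1_small (x : R) : - (2 * PI) < x < 2 * PI -> cos x = 1 -> x = 0.
Proof.
intros Hx H.
assert (Hs : sin (x / 2) = 0).
{ replace x with (2 * (x / 2)) in H by field.
  rewrite cos_2a_sin in H; nra. }
destruct (Rtotal_order x 0) as [Hn | [H0 | Hp]]; trivial.
- assert (0 < sin (- (x / 2))) by (apply sin_gt_0; lra).
  rewrite sin_neg in *; lra.
- assert (0 < sin (x / 2)) by (apply sin_gt_0; lra); lra.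
Qed.

Lemma sph_injective (q r : R2) :
  0 < fst q < PI -> 0 < fst r < PI -> - (2 * PI) < snd q - snd r < 2 * PI ->
  sph q = sph r -> q = r.
Proof.
destruct q as [phi theta], r as [phi' theta']; simpl; intros Hp Hp' Ht E.
unfold sph in E; simpl in E; injection E as H1 H2 H3.
assert (phi = phi').
{ rewrite <- (acos_cos phi), <- (acos_cos phi'), H3 by lra; trivial. }
subst phi'; f_equal.
assert (Hs : 0 < sin phi) by (apply sin_gt_0; lra).
apply Rmult_eq_reg_l in H1, H2; try lra.
enough (theta - theta' = 0) by lra.
apply cos_eq_1_small; trivial.
rewrite cos_minus, H1, H2.
generalize (sin2_cos2 theta'); unfold Rsqr; lra.
Qed.

Lemma det3_frame_sph (q : R2) :
  det3 (sph q) (frame sph i1 q) (frame sph i2 q) = sin (fst q).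
Proof.
rewrite frame_sph_phi, frame_sph_theta; destruct q as [phi theta].
unfold det3, d_theta, sph, x1, x2, x3; simpl.
generalize (sin2_cos2 phi) (sin2_cos2 theta); unfold Rsqr; intros Hp Ht.
transitivity (sin phi * (sin phi * sin phi + cos phi * cos phi)
  * (sin theta * sin theta + cos theta * cos theta)); [ring | rewrite Hp, Ht; ring].
Qed.

(** A full turn of longitudes, centred anywhere, so that these charts reach
every point with 0 < phi < PI. *)
Lemma sph_chart (theta0 : R) : oriented_chart
  (fun q : R * R => 0 < fst q < PI /\ theta0 - PI < snd q < theta0 + PI) sph.
Proof.
assert (HD : open (fun q : R * R => 0 < fst q < PI /\ theta0 - PI < snd q < theta0 + PI)).
{ assert (Ho : forall a b : R, open (fun x : R => a < x < b))
    by (intros a b; apply open_and; [apply open_gt | apply open_lt]).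
  apply open_and.
  - apply (open_comp fst (fun x : R => 0 < x < PI)); trivial.
    intros; apply continuous_fst.
  - apply (open_comp snd (fun x : R => theta0 - PI < x < theta0 + PI)); trivial.
    intros; apply continuous_snd. }
destruct (smooth_sph _ _ _ HD is_linear_fst is_linear_snd) as (S1 & S2' & S3).
split; [exact HD|].
split; [intros q _; apply sph_S2|].
split; [exact S1|].
split; [exact S2'|].
split; [exact S3|].
split.
- intros q r [Hq Hq'] [Hr Hr']; apply sph_injective; trivial; lra.
- intros q [Hq _]; rewrite det3_frame_sph; now apply sin_gt_0.
Qed.

(** Scalar products with the unit vectors e_phi and e_theta, defined also at the
poles. *)
Definition comp_phi (q : R2) (h : R3) : R :=
  x1 h * (cos (fst q) * cos (snd q)) + x2 h * (cos (fst q) * sin (snd q))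
  - x3 h * sin (fst q).

Definition comp_theta (q : R2) (h : R3) : R :=
  x2 h * cos (snd q) - x1 h * sin (snd q).

Lemma comp_sph_phi (u : R3 -> R3) q : regular q ->
  Defs.comp sph u i1 q = comp_phi q (u (sph q)).
Proof.
intros Hq; unfold Defs.comp, sum2; rewrite !ginv_sph, frame_sph_phi by trivial.
unfold comp_phi, dot, x1, x2, x3; simpl; ring.
Qed.

Lemma comp_sph_theta (u : R3 -> R3) q : regular q ->
  Defs.comp sph u i2 q = comp_theta q (u (sph q)) / sin (fst q).
Proof.
intros Hq; unfold Defs.comp, sum2; rewrite !ginv_sph, frame_sph_theta by trivial.
unfold comp_theta, dot, d_theta, sph, x1, x2, x3; simpl; field; exact Hq.
Qed.

Lemma dot_frame_sph (q : R2) (h : R3) : dot (sph q) h = 0 ->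
  dot h h = comp_phi q h ^ 2 + comp_theta q h ^ 2.
Proof.
destruct q as [phi theta], h as [[a b] d].
unfold dot, comp_phi, comp_theta, sph, x1, x2, x3; simpl; intros H.
generalize (sin2_cos2 phi) (sin2_cos2 theta); unfold Rsqr; intros Hp Ht.
set (r := a * cos theta + b * sin theta).
set (y := b * cos theta - a * sin theta).
assert (Hn : sin phi * r + cos phi * d = 0) by (unfold r; rewrite <- H; ring).
assert (Hy : a * a + b * b = r * r + y * y).
{ transitivity ((a * a + b * b) * (sin theta * sin theta + cos theta * cos theta));
    [rewrite Ht; ring | unfold r, y; ring]. }
transitivity ((r * r + d * d) * (sin phi * sin phi + cos phi * cos phi) + y * y).
  rewrite Hp; lra.
transitivity ((sin phi * r + cos phi * d) ^ 2 + (cos phi * r - sin phi * d) ^ 2 + y * y).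
  ring.
rewrite Hn; unfold r; ring.
Qed.

(** The field d_theta has component sin phi along e_theta and none along e_phi. *)
Lemma dot_uhat (c : R) (q : R2) (h : R3) :
  let u := plus (uK c (sph q)) h in
  dot (sph q) u = 0 ->
  dot h h = comp_phi q u ^ 2 + (comp_theta q u - c * sin (fst q)) ^ 2.
Proof.
intros u Hu.
assert (Hu1 : u = (x1 h - c * (sin (fst q) * sin (snd q)),
    x2 h + c * (sin (fst q) * cos (snd q)), x3 h)).
{ destruct h as [[a b] d]; unfold u, uK, d_theta, sph, x1, x2, x3; simpl.
  do 4 (unfold prod_plus, prod_scal, plus, scal, mult; simpl).
  f_equal; [f_equal|]; ring. }
clearbody u; subst u.
rewrite (dot_frame_sph q h).
- f_equal; [f_equal | f_equal]; unfold comp_phi, comp_theta, x1, x2, x3; simpl; [ring|].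
  generalize (sin2_cos2 (snd q)); unfold Rsqr; intros Ht.
  replace (c * sin (fst q)) with
    (c * sin (fst q) * (sin (snd q) * sin (snd q) + cos (snd q) * cos (snd q)))
    by (rewrite Ht; ring).
  ring.
- rewrite <- Hu; unfold dot, sph, x1, x2, x3; simpl; ring.
Qed.

Lemma spherical_periodic (phi theta : R) :
  sph (phi, theta + 2 * PI) = sph (phi, theta) /\
  (forall h, comp_phi (phi, theta + 2 * PI) h = comp_phi (phi, theta) h) /\
  (forall h, comp_theta (phi, theta + 2 * PI) h = comp_theta (phi, theta) h).
Proof.
replace (theta + 2 * PI) with (theta + 2 * INR 1 * PI) by (simpl; ring).
unfold comp_phi, comp_theta, sph, fst, snd; now rewrite cos_period, sin_period.
Qed.

Lemma sph_pole (phi theta : R) : sin phi = 0 -> sph (phi, theta) = (0, 0, cos phi).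
Proof. intros H; unfold sph; simpl; rewrite H; f_equal; f_equal; ring. Qed.

Theorem theorem8p1 (mu omega c : R) (T0 T1 : Rbar)
    (uhat : R -> R3 -> R3) (phat : R -> R3 -> R) :
  0 < mu ->
  NS_solution mu (coriolis omega)
    (fun t : R => Rbar_lt T0 t /\ Rbar_lt t T1)
    (fun t x => plus (uK c x) (uhat t x))
    (fun t x => pK omega c x + phat t x) ->
  forall t : R, Rbar_lt T0 t -> Rbar_lt t T1 ->
  exists l : R, is_derive (fun s : R => sqnorm (uhat s)) t l /\ l <= 0.
Proof.
intros Hmu [[Htan [Su1 [Su2 Su3]]] [Sp Heq]] t Ht0 Ht1.
set (J := fun t : R => Rbar_lt T0 t /\ Rbar_lt t T1) in *.
set (u := fun (t : R) (x : R3) => plus (uK c x) (uhat t x) : R3) in *.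
set (pr := fun (t : R) (x : R3) => pK omega c x + phat t x) in *.
assert (HJ : open J) by (apply open_and; [apply open_Rbar_gt | apply open_Rbar_lt]).
assert (Ht : J t) by now split.
set (v := fun x : R * (R * R) => comp_phi (snd x) (u (fst x) (sph (snd x)))).
set (W := fun x : R * (R * R) => comp_theta (snd x) (u (fst x) (sph (snd x)))).
set (p := fun x : R * (R * R) => pr (fst x) (sph (snd x))).
set (D := fun x : R * (R * R) => J (fst x)).
assert (HD : open D) by now apply open_time.
apply (smooth_S2_sph J) in Su1, Su2, Su3; trivial.
assert (SP : smooth D p) by (now apply smooth_S2_sph).
destruct (smooth_sin_cos_linear D _ HD is_linear_phi) as [Ssp Scp].
destruct (smooth_sin_cos_linear D _ HD is_linear_theta) as [Sst Sct].
assert (Sv : smooth D v).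
{ refine (smooth_minus D _ _ HD (smooth_plus D _ _ HD _ _) _);
    repeat apply smooth_mult; trivial. }
assert (SW : smooth D W).
{ refine (smooth_minus D _ _ HD _ _); repeat apply smooth_mult; trivial. }
set (w := Defs.comp sph (u t)).
assert (Hchart : forall q : R2, 0 < fst q < PI ->
  (forall k, Derive (fun s => Defs.comp sph (u s) k q) t + nabla sph w w k q
     - mu * Lop sph w k q + coriolis omega (sph q) * Kop sph w k q
     + gradient sph (fun r => p (t, r)) k q = 0) /\ divergence sph w q = 0).
{ intros q Hq; apply (Heq _ sph (sph_chart (snd q)) t q Ht).
  split; trivial; generalize PI_RGT_0; lra. }
assert (Hreg : forall q : R2, 0 < fst q < PI -> regular q).
{ intros q Hq; apply Rgt_not_eq; apply sin_gt_0; apply Hq. }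
assert (Hcor : forall q : R2, 0 < fst q < PI ->
  coriolis omega (sph q) = 2 * omega * cos (fst q)).
{ intros [phi theta] Hq; unfold coriolis; simpl in Hq.
  rewrite colatitude_sph by lra; trivial. }
exists (RInt (fun phi => RInt (fun theta =>
  dirD et (density c v W) (t, (phi, theta))) 0 (2 * PI)) 0 PI).
split.
- assert (HPI := PI_RGT_0).
  apply (is_derive_ext_loc (fun s => RInt (fun phi => RInt (fun theta =>
    density c v W (s, (phi, theta))) 0 (2 * PI)) 0 PI)).
  + generalize (HJ t Ht); apply filter_imp; intros s Hs.
    unfold sqnorm, integral_S2; apply RInt_ext; intros phi Hphi.
    rewrite Rmin_left, Rmax_right in Hphi by lra.
    apply RInt_ext; intros theta _.
    rewrite detg_sph, sqrt_pow2 by (left; apply sin_gt_0; apply Hphi).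
    unfold density; simpl; f_equal; symmetry.
    apply dot_uhat, (Htan s); trivial; apply sph_S2.
  + apply (is_derive_RInt2 J); trivial; try lra.
    now apply smooth_density.
- apply (energy_rate_nonpos J mu omega c t v W p w); trivial.
  + intros q Hq; now apply comp_sph_phi.
  + intros q Hq; now apply comp_sph_theta.
  + intros [phi theta] Hq; rewrite <- (proj1 (Hchart _ Hq) i1), <- Hcor by trivial.
    do 4 f_equal; symmetry; apply is_derive_unique.
    apply (is_derive_ext (fun s => v (s, (phi, theta)))).
      intros s; symmetry; now apply comp_sph_phi, Hreg.
    now apply (is_derive_t D).
  + intros [phi theta] Hq; rewrite <- (proj1 (Hchart _ Hq) i2), <- Hcor by trivial.
    do 4 f_equal; symmetry; apply is_derive_unique.
    apply (is_derive_ext (fun s => / sin phi * W (s, (phi, theta)))).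
      intros s; rewrite comp_sph_theta by now apply Hreg.
      apply Rmult_comm.
    evar_last; [apply is_derive_scal; now apply (is_derive_t D)|].
    apply Rmult_comm.
  + intros q Hq; now apply Hchart.
  + intros [s [phi theta]]; rewrite plus_turn; unfold v; simpl.
    destruct (spherical_periodic phi theta) as (-> & -> & _); trivial.
  + intros [s [phi theta]]; rewrite plus_turn; unfold W; simpl.
    destruct (spherical_periodic phi theta) as (-> & _ & ->); trivial.
  + intros [s [phi theta]]; rewrite plus_turn; unfold p; simpl.
    destruct (spherical_periodic phi theta) as (-> & _); trivial.
  + intros theta; apply (is_derive_inj (fun r => v (t, (0, r))) theta).
      now apply (is_derive_theta D).
    unfold v, W, comp_phi, comp_theta; simpl.
    rewrite (sph_pole 0 theta sin_0).
    apply (is_derive_ext (fun r =>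
      x1 (u t (0, 0, cos 0)) * (cos 0 * cos r) + x2 (u t (0, 0, cos 0)) * (cos 0 * sin r)
      - x3 (u t (0, 0, cos 0)) * sin 0)).
      intros r; now rewrite (sph_pole 0 r sin_0).
    auto_derive; trivial; rewrite cos_0; ring.
  + intros theta; apply (is_derive_inj (fun r => v (t, (PI, r))) theta).
      now apply (is_derive_theta D).
    unfold v, W, comp_phi, comp_theta; simpl.
    rewrite (sph_pole PI theta sin_PI).
    apply (is_derive_ext (fun r =>
      x1 (u t (0, 0, cos PI)) * (cos PI * cos r)
      + x2 (u t (0, 0, cos PI)) * (cos PI * sin r)
      - x3 (u t (0, 0, cos PI)) * sin PI)).
      intros r; now rewrite (sph_pole PI r sin_PI).
    auto_derive; trivial; rewrite cos_PI; ring.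
Qed.
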